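(* Let $G$ be a finite simple graph embedded in a connected closed surface $\Sigma$, let $\mathcal F$ be a nonempty proper subset of the set $\mathcal F(G)$ of faces consisting of even faces, let $H$ be a connected component of the resonance graph $R(G;\mathcal F)$, and fix $M_*\in V(H)$. The facial parity embedding $x:V(H)\to\{0,1\}^{\mathcal F}$ (based at $M_*$) is isometric, where $V(H)$ carries the graph distance of $H$ and $\{0,1\}^{\mathcal F}$ the Hamming distance, if and only if for every $f\in\mathcal F$ the quotient graph $T_f$ has at most one edge.
   Context: Surfaces may be orientable or nonorientable. A face of the embedded graph $G$ is a connected component of $\Sigma\setminus G$; $\partial f$ denotes the frontier of a face $f$ in $\Sigma$, and $\mathcal F(G)$ is the set of all faces. A face $f$ is even if $\partial f$ is a simple cycle of $G$ of even length; then $E(f)$ is the edge set of this cycle. No regularity is imposed on the other faces: the embedding need not be cellular, and $G$ need not be connected or bipartite. A perfect matching of $G$ is a set of edges incident with each vertex exactly once. The resonance graph $R(G;\mathcal F)$ has the perfect matchings of $G$ as vertices, with $M$ adjacent to $N$ precisely when $M\triangle N=E(f)$ for some $f\in\mathcal F$, where $\triangle$ is symmetric difference. Facial parity embedding: for $M\in V(H)$ there is a unique subset $B\subseteq\mathcal F$ such that $M\triangle M_*$ equals the symmetric difference of the sets $E(f)$, $f\in B$; $x(M)\in\{0,1\}^{\mathcal F}$ is the characteristic vector of this $B$. The Hamming distance between two binary vectors is the number of coordinates in which they differ. Quotient graphs: for $f\in\mathcal F$, $E_f(H)$ is the set of edges $MN$ of $H$ with $M\triangle N=E(f)$. The graph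 $T_f$ is obtained from $H$ by contracting every connected component of $H-E_f(H)$ (edge deletion, all vertices kept) to a vertex and retaining the edges induced by $E_f(H)$, with parallel edges replaced by one edge. *)

(* Defs.v *)
From HB Require Import structures.
From mathcomp Require Import all_boot all_order all_algebra.
From mathcomp Require Import all_classical all_reals all_analysis.

Set Implicit Arguments.
Unset Strict Implicit.
Unset Printing Implicit Defensive.

Import Order.TTheory GRing.Theory Num.Theory.
Import numFieldNormedType.Exports.

Local Open Scope ring_scope.

Section SymmetricDifference.
Variable T : finType.
Implicit Types A B C : {set T}.

Definition symd A B : {set T} := (A :\: B) :|: (B :\: A).

Lemma in_symd A B x : (x \in symd A B) = (x \in A) (+) (x \in B).
Proof. by rewrite !inE; case: (x \in A); case: (x \in B). Qed.

Lemma symdA : associative symd.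
Proof. by move=> A B C; apply/setP => x; rewrite !in_symd addbA. Qed.

Lemma symdC : commutative symd.
Proof. by move=> A B; apply/setP => x; rewrite !in_symd addbC. Qed.

Lemma sym0d : left_id finset.set0 symd.
Proof. by move=> A; apply/setP => x; rewrite in_symd inE. Qed.

HB.instance Definition _ :=
  Monoid.isComLaw.Build {set T} finset.set0 symd symdA symdC sym0d.

End SymmetricDifference.

(* A finite simple graph with vertex set D and adjacency relation e. *)
Section FiniteGraphs.
Variable T : finType.
Implicit Types (D : {set T}) (e : rel T).

Definition restrict_rel D e : rel T :=
  [rel x y | [&& x \in D, y \in D & e x y]].

Definition component D e (x : T) : {set T} :=
  [set y in D | connect (restrict_rel D e) x y].

Definition is_component D e (H : {set T}) : Prop :=
  exists2 x, x \in D & H = component D e x.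

Definition has_walk e (x y : T) (n : nat) : bool :=
  [exists p : n.-tuple T, path e x p && (last x p == y)].

(* The least length of an e-walk from x to y.  A shortest walk has length less
   than #|T|, so the search bound is never reached when x and y are connected;
   the value is #|T| when they are not. *)
Definition graph_dist e (x y : T) : nat :=
  find (has_walk e x y) (iota 0 #|T|).

End FiniteGraphs.

Section Graph.
Variables (V : finType) (adj : rel V).

Definition edges : {set {set V}} :=
  [set e | [exists u, exists v, adj u v && (e == [set u; v]%SET)]].

Definition perfect_matching (M : {set {set V}}) : bool :=
  (M \subset edges) && [forall v, #|[set e in M | v \in e]| == 1%N].

Definition perfect_matchings : {set {set {set V}}} :=
  [set M | perfect_matching M].

Definition simple_cycle (c : seq V) : Prop := ucycle adj c /\ (2 < size c)%N.

Definition cycle_edges (c : seq V) : {set {set V}} :=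
  [set [set v; next c v]%SET | v in c].

End Graph.

Local Open Scope classical_set_scope.

Section Surfaces.
Variables (R : realType) (S : topologicalType).

(* U is homeomorphic to the plane, equivalently to an open disc. *)
Definition planar_chart (U : set S) : Prop :=
  exists (f : S -> R * R) (g : R * R -> S),
    [/\ {within U, continuous f}, continuous g,
        forall z, U (g z), cancel g f & {in U, cancel f g}].

Definition connected_closed_surface : Prop :=
  [/\ hausdorff_space S, compact [set: S], connected [set: S] &
      forall p : S, exists U : set S, [/\ open U, U p & planar_chart U]].

Definition frontier (A : set S) : set S := closure A `\` interior A.

End Surfaces.

(* Arcs are arbitrary topological arcs: neither tameness nor cellularity is
   assumed.  The values of edge_arc off the edges of the graph, and outside
   [0, 1], are irrelevant. *)
Record embedding (R : realType) (V : finType) (adj : rel V)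
    (S : topologicalType) := Embedding {
  vertex_point : V -> S;
  edge_arc : {set V} -> R -> S;
  vertex_point_inj : injective vertex_point;
  edge_arc_continuous : forall e, e \in edges adj ->
    {within `[0, 1], continuous (edge_arc e)};
  edge_arc_inj : forall e, e \in edges adj ->
    {in `[0, 1] &, injective (edge_arc e)};
  edge_arc_ends : forall e, e \in edges adj ->
    [set edge_arc e 0; edge_arc e 1] = vertex_point @` [set v | v \in e];
  edge_arc_vertex : forall e, e \in edges adj ->
    edge_arc e @` `]0, 1[ `&` range vertex_point = set0;
  edge_arc_disjoint : forall e e', e \in edges adj -> e' \in edges adj ->
    e != e' -> edge_arc e @` `]0, 1[ `&` edge_arc e' @` `]0, 1[ = set0
}.

Section Faces.
Variables (R : realType) (V : finType) (adj : rel V) (S : topologicalType).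
Variable G : embedding R adj S.

Definition drawn_edge (e : {set V}) : set S := edge_arc G e @` `[0, 1].

Definition drawn_graph : set S :=
  range (vertex_point G) `|` \bigcup_(e in [set e | e \in edges adj]) drawn_edge e.

Definition faces : set (set S) :=
  [set f | exists2 p, (~` drawn_graph) p &
                      f = connected_component (~` drawn_graph) p].

Definition frontier_cycle (f : set S) (c : seq V) : Prop :=
  simple_cycle adj c /\
  frontier f = \bigcup_(e in [set e | e \in cycle_edges c]) drawn_edge e.

Definition even_faces : set (set S) :=
  [set f | faces f /\ exists2 c, frontier_cycle f c & ~~ odd (size c)].

(* The drawn cycle determines its edge set, so for an even face f the choice of
   the vertex sequence c (starting point, direction) is irrelevant. *)
Definition face_edges (f : set S) : {set {set V}} :=
  [set e : {set V} | `[< exists2 c, frontier_cycle f c & e \in cycle_edges c >]]%SET.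

End Faces.

Section Resonance.
Variables (R : realType) (V : finType) (adj : rel V) (S : topologicalType).
Variables (G : embedding R adj S) (F : set (set S)).

Local Notation matching := {set {set V}}.
Implicit Types (M N : matching) (H : {set matching}) (f : set S).

(* Adjacency in the resonance graph, whose vertex set is perfect_matchings. *)
Definition resonant : rel matching :=
  [rel M N | `[< exists2 f, F f & symd M N = face_edges G f >]].

Definition is_resonance_component H : Prop :=
  is_component (perfect_matchings adj) resonant H.

Definition component_rel H : rel matching := restrict_rel H resonant.

(* The subset B of F attached to M.  Finiteness of B only makes the iterated
   symmetric difference meaningful: there are finitely many even faces. *)
Definition parity_set (Mstar M : matching) : set (set S) :=
  get [set B : set (set S) |
        [/\ finite_set B, B `<=` F &
            symd M Mstar = \big[@symd _/finset.set0]_(f \in B) face_edges G f]].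

(* Binary vectors indexed by F are functions set S -> bool, of which only the
   values on F matter. *)
Definition facial_parity (Mstar M : matching) : set S -> bool :=
  fun f => f \in parity_set Mstar M.

Definition hamming_dist_eq (u v : set S -> bool) (n : nat) : Prop :=
  ([set f | F f /\ u f != v f] #= `I_n)%card.

Definition isometric_on H (x : matching -> set S -> bool) : Prop :=
  forall M N, M \in H -> N \in H ->
    hamming_dist_eq (x M) (x N) (graph_dist (component_rel H) M N).

Definition class_rel H f : rel matching :=
  [rel M N | component_rel H M N && (symd M N == face_edges G f)].

Definition rest_rel H f : rel matching :=
  [rel M N | component_rel H M N && (symd M N != face_edges G f)].

(* The vertices of T_f are the sets component H (rest_rel H f) M with M in H;
   an edge of T_f is the unordered pair of its end vertices, so that parallel
   edges are identified (a loop, if there were one, would count as an edge). *)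
Definition quotient_edges H f : {set {set {set matching}}} :=
  [set [set component H (rest_rel H f) MN.1;
            component H (rest_rel H f) MN.2]
  | MN in [set MN : matching * matching | class_rel H f MN.1 MN.2]]%SET.

End Resonance.

(* Main.v *)
(* Two facts about the surface carry the argument. (i) An arc has at most two
   local sides, so an edge lies on the boundary of at most two faces of F.
   (ii) If every edge of every boundary of a finite nonempty set Z of even faces
   lies on the boundary of two members of Z, then the union of their closures
   can only have vertices on its frontier, hence is the whole surface, and Z
   consists of all faces; as F is proper this never happens inside F.
   By (ii) the sets E(f) are linearly independent over the field of two elements.
   More strongly, the two perfect matchings of the cycle E(f) give every flip of f
   a sign, and along a closed walk in the resonance graph the signed number s(f)
   of flips of f satisfies a relation +-s(f) +- s(g) = 0 for every edge between f
   and g (and s(f) = 0 if f is the only face of F at that edge), so (ii) forces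
   s = 0: flips have a height function.
   By independence, the parity embedding is isometric iff any two matchings are
   joined by a geodesic flipping no face twice. If a geodesic flips f twice,
   without repetition in between, then either the state of f is unchanged between
   the two flips, which by (i) can then both be deleted, or the two flips have the
   same sign, and T_f has two edges, at different heights. Conversely, if two
   edges of T_f are given, then, by parity, geodesics without repetition between
   their suitably paired ends avoid f, and the two edges coincide. *)

Require Import Defs.
From HB Require Import structures.
From mathcomp Require Import all_boot all_order all_algebra.
From mathcomp Require Import finmap.
From mathcomp Require Import all_classical all_reals all_analysis.
From mathcomp Require Import ring lra zify.

Set Implicit Arguments.
Unset Strict Implicit.
Unset Printing Implicit Defensive.

Import Order.TTheory GRing.Theory Num.Theory.
Import numFieldNormedType.Exports.

Local Open Scope classical_set_scope.
Local Open Scope ring_scope.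

(** * Continuous arguments of plane unit vectors *)

Section UnitVectors.
Variable R : realType.
Implicit Types (u v : R * R) (s t : R).

(* The plane is used as the complex numbers; on unit vectors cconj is inversion. *)
Definition cmul u v : R * R := (u.1 * v.1 - u.2 * v.2, u.1 * v.2 + u.2 * v.1).
Definition cconj u : R * R := (u.1, - u.2).
Definition expi t : R * R := (cos t, sin t).
Definition unitv u := u.1 ^+ 2 + u.2 ^+ 2 = 1.

Definition cpow u (c : int) : R * R :=
  match c with
  | Posz n => iter n (cmul u) (1, 0)
  | Negz n => iter n.+1 (cmul (cconj u)) (1, 0)
  end.

Lemma expi0 : expi 0 = (1, 0). Proof. by rewrite /expi cos0 sin0. Qed.

Lemma expiD s t : expi (s + t) = cmul (expi s) (expi t).
Proof. by rewrite /expi /cmul cosD sinD /= addrC [in RHS]addrC; congr (_, _); ring. Qed.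

Lemma expiN t : expi (- t) = cconj (expi t).
Proof. by rewrite /expi cosN sinN. Qed.

Lemma unitv_expi t : unitv (expi t).
Proof. exact: cos2Dsin2. Qed.

Lemma expi_cpow t (c : int) : cpow (expi t) c = expi (c%:~R * t).
Proof.
case: c => n /=.
  rewrite -[_%:~R]/(n%:R).
  elim: n => [|n IH] /=; first by rewrite mul0r expi0.
  by rewrite IH -expiD; congr expi; rewrite -[n.+1]addn1 natrD; ring.
rewrite NegzE -expiN.
have -> : (- n.+1%:Z)%:~R * t = n.+1%:R * (- t) by rewrite mulrNz; ring.
elim: n => [|n IH] /=; first by rewrite mul1r -expi0 -expiD addr0.
rewrite /= in IH; rewrite IH -expiD; congr expi.
by rewrite -[n.+2]addn1 natrD; ring.
Qed.

Lemma unitv_arg u : unitv u -> exists t, u = expi t.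
Proof.
case: u => a b; rewrite /unitv /= => uab.
have a1 : -1 <= a <= 1 by apply/andP; split; nra.
have sE : sin (acos a) = `|b|.
  by rewrite sin_acos// (_ : 1 - a ^+ 2 = b ^+ 2) ?sqrtr_sqr//; lra.
have cE : cos (acos a) = a by apply: acosK; rewrite in_itv.
have [b0|b0] := leP 0 b.
  by exists (acos a); rewrite /expi sE cE ger0_norm.
by exists (- acos a); rewrite /expi sinN cosN sE cE ltr0_norm// opprK.
Qed.

(** Subtracting the multiple of [2 pi] given by the floor leaves [d] in [[0, 2 pi[] with
    [cos d = 1]. Injectivity of the cosine on [[0, pi]], applied to [d] or to [2 pi - d], gives
    [d = 0]. *)
Lemma expi_inj s t : expi s = expi t -> exists n : int, s = t + n%:~R * (pi *+ 2).
Proof.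
move=> [cst sst].
have pi2 : 0 < (pi *+ 2 : R) by rewrite pmulrn_lgt0 ?pi_gt0.
pose n := Num.floor ((s - t) / (pi *+ 2)).
exists n; pose d := s - t - n%:~R * (pi *+ 2).
suff : d = 0 by rewrite /d; lra.
have d0 : 0 <= d.
  rewrite /d subr_ge0 -ler_pdivlMr//; exact: floor_le_tmp.
have d1 : d < pi *+ 2.
  have := floorD1_gt ((s - t) / (pi *+ 2)); rewrite -/n intrD ltr_pdivrMr//.
  by rewrite /d; lra.
have cd : cos d = 1.
  have : expi d = expi 0.
    have <- : cmul (expi (s - t)) (expi (- (n%:~R * (pi *+ 2)))) = expi d.
      by rewrite -expiD.
    have -> : expi (- (n%:~R * (pi *+ 2))) = expi 0.
      rewrite -mulNr -intrN -expi_cpow.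
      have -> : expi (pi *+ 2) = expi 0 :> R * R.
        by rewrite /expi cos2pi sin2pi cos0 sin0.
      by rewrite expi_cpow mulr0.
    rewrite -expiD addr0 expiD expiN.
    rewrite /expi cst sst /cmul /cconj /= cos0 sin0; congr (_, _); last by ring.
    by rewrite mulrN opprK -!expr2 cos2Dsin2.
  by rewrite /expi cos0 => -[].
have [dpi|dpi] := leP d pi.
  by apply: cos_inj; rewrite ?in_itv/= ?d0 ?dpi ?lexx ?pi_ge0 ?cos0.
exfalso; have : pi *+ 2 - d = 0; last by lra.
apply: cos_inj; rewrite ?in_itv/= ?lexx ?pi_ge0//.
  by apply/andP; split; [lra|rewrite mulr2n; lra].
by rewrite cosB cos2pi sin2pi cd cos0; ring.
Qed.

Lemma unitv_cmul u v : unitv u -> unitv v -> unitv (cmul u v).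
Proof.
by move=> /unitv_arg[s ->] /unitv_arg[t ->]; rewrite -expiD; exact: unitv_expi.
Qed.

Lemma unitv_cconj u : unitv u -> unitv (cconj u).
Proof. by move=> /unitv_arg[s ->]; rewrite -expiN; exact: unitv_expi. Qed.

Lemma unitv_cpow u c : unitv u -> unitv (cpow u c).
Proof. by move=> /unitv_arg[s ->]; rewrite expi_cpow; exact: unitv_expi. Qed.

(** In the open right half-plane the principal argument is the arcsine of the second coordinate,
    which is continuous there. *)
Lemma expi_asin u : unitv u -> 0 < u.1 -> expi (asin u.2) = u.
Proof.
case: u => a b; rewrite /unitv /= => uab a0.
have b1 : -1 <= b <= 1 by apply/andP; split; nra.
rewrite /expi cos_asin//; congr (_, _); last by apply: asinK; rewrite in_itv.
rewrite (_ : 1 - b ^+ 2 = a ^+ 2) ?sqrtr_sqr ?gtr0_norm//; lra.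
Qed.

Section Continuity.
Variables (T : topologicalType) (z : T).
Implicit Types f g : T -> R * R.

Lemma cvg_pairP f u : f @ z --> u <->
  (fun y => (f y).1) @ z --> u.1 /\ (fun y => (f y).2) @ z --> u.2.
Proof.
split=> [fu|[f1 f2]].
  by split; [apply: (cvg_comp f fst fu); exact: cvg_fst
            |apply: (cvg_comp f snd fu); exact: cvg_snd].
case: u f1 f2 => u1 u2 /= f1 f2.
rewrite (_ : f = (fun y => ((f y).1, (f y).2))); last first.
  by apply/funext => y; case: (f y).
exact: (cvg_pair f1 f2).
Qed.

Lemma cmul_continuous f g : {for z, continuous f} -> {for z, continuous g} ->
  {for z, continuous (fun y => cmul (f y) (g y))}.
Proof.
move=> /cvg_pairP[f1 f2] /cvg_pairP[g1 g2]; apply/cvg_pairP; split => /=.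
  by apply: (@cvgB _ R); apply: cvgM.
by apply: (@cvgD _ R); apply: cvgM.
Qed.

Lemma cconj_continuous f : {for z, continuous f} ->
  {for z, continuous (fun y => cconj (f y))}.
Proof.
move=> /cvg_pairP[f1 f2]; apply/cvg_pairP; split => //=.
exact: (@cvgN _ R).
Qed.

Lemma cpow_continuous f c : {for z, continuous f} ->
  {for z, continuous (fun y => cpow (f y) c)}.
Proof.
move=> cf; case: c => n /=; first last.
  apply: cmul_continuous; first exact: cconj_continuous.
  elim: n => [|n IH] /=; first exact: cvg_cst.
  by apply: cmul_continuous => //; exact: cconj_continuous.
elim: n => [|n IH] /=; first exact: cvg_cst.
exact: cmul_continuous.
Qed.

Lemma expi_continuous (h : T -> R) : {for z, continuous h} ->
  {for z, continuous (fun y => expi (h y))}.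
Proof.
move=> ch; apply/cvg_pairP; split => /=.
  exact: (continuous_comp ch (@continuous_cos _ _)).
exact: (continuous_comp ch (@continuous_sin _ _)).
Qed.

Lemma asin_continuous f : {for z, continuous f} -> unitv (f z) -> 0 < (f z).1 ->
  {for z, continuous (fun y => asin (f y).2)}.
Proof.
move=> /cvg_pairP[_ f2]; rewrite /unitv => u f0.
apply: (@continuous_comp _ _ _ (fun y => (f y).2) (@asin R)) => //.
by apply: continuous_asin; apply/andP; split; nra.
Qed.

End Continuity.

End UnitVectors.

(** * Lifting circle-valued maps on star-shaped compact sets *)

Section Lifting.
Variable R : realType.

(** The last expression is the inner product of [h z] and [h w]. Two unit vectors that are both
    within 1/4 of a third one, coordinatewise, have positive inner product; compactness makes the
    distance [d] uniform. *)
Lemma unif_dot_gt0 (V : normedModType R) (D : set V) (h : V -> R * R) :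
  compact D -> (forall z, D z -> {for z, continuous h}) ->
  (forall z, D z -> unitv (h z)) ->
  exists2 d : R, 0 < d & forall z w, D z -> D w -> `|z - w| < d ->
    0 < (cmul (cconj (h z)) (h w)).1.
Proof.
move=> cD ch uh.
pose P (d : R) (z : V) := forall w, D z -> D w -> `|z - w| < d ->
  0 < (cmul (cconj (h z)) (h w)).1.
have /compact_near_coveringP/(_ R (0^'+) P _) := cD.
case=> [z Dz|e /= e0 He].
  have /cvgrPdist_lt/(_ 4^-1) H4 := ch z Dz.
  have [|e /= e0 He] := (nbhs_ballP z _).1 (H4 _).
    by rewrite invr_gt0.
  exists (ball z (e / 2), [set d | d < e / 2]).
    split => /=; first by apply: nbhsx_ballx; rewrite divr_gt0.
    by apply: nbhs_right_lt; rewrite divr_gt0.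
  move=> [w d] /= [+ de] y Dw Dy wy.
  rewrite -ball_normE /= => zw; rewrite -ball_normE /= in He.
  have Hw : `|h z - h w| < 4^-1.
    by apply: He => /=; lra.
  have Hy : `|h z - h y| < 4^-1.
    apply: He => /=; rewrite (_ : z - y = (z - w) + (w - y)); last by rewrite addrA subrK.
    apply: le_lt_trans (ler_normD _ _) _.
    by lra.
  move: Hw Hy; rewrite !prod_normE !gt_max => /andP[/= + +] /andP[+ +].
  have := uh _ Dw; have := uh _ Dy; rewrite /unitv.
  rewrite !ltr_norml => uy uw /andP[a1 a2] /andP[a3 a4] /andP[a5 a6] /andP[a7 a8].
  by rewrite /cmul /cconj /=; nra.
exists (e / 2); first by rewrite divr_gt0.
move=> z w Dz Dw zw; apply: (He (e / 2)) => //=; last by rewrite divr_gt0.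
by rewrite sub0r normrN gtr0_norm ?divr_gt0//; lra.
Qed.

(* The lift is the sum, over a fine subdivision of the segment from p to z, of
   the small arguments of the quotients of consecutive values of h. *)
Lemma starshaped_arg (V : normedModType R) (D : set V) (p : V) (h : V -> R * R) :
  compact D -> D p ->
  (forall z t, D z -> 0 <= t <= 1 -> D (p + t *: (z - p))) ->
  (forall z, D z -> {for z, continuous h}) ->
  (forall z, D z -> unitv (h z)) ->
  exists T : V -> R, forall z, D z -> {for z, continuous T} /\ h z = expi (T z).
Proof.
move=> cD Dp star ch uh.
have [d d0 Hd] := unif_dot_gt0 cD ch uh.
have [M [_ /(_ (`|M| + 1))HM]] := compact_bounded cD.
have {}HM z : D z -> `|z| <= `|M| + 1.
  by apply: HM; apply: le_lt_trans (ler_norm _) _; rewrite ltrDl.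
(* Consecutive subdivision points differ by [(z - p) / n], whose norm is at most
   [2 (|M| + 1) / n < d]. *)
pose n := (Num.truncn ((`|M| + 1) * 2 / d)).+1.
have nP : (`|M| + 1) * 2 / d < n%:R by exact: truncnS_gt.
have n0 : 0 < n%:R :> R by rewrite ltr0n.
pose pt k (z : V) := p + (k%:R / n%:R) *: (z - p).
have ptD k z : (k <= n)%N -> D z -> D (pt k z).
  move=> kn Dz; apply: star => //; rewrite divr_ge0//=.
  by rewrite ler_pdivrMr// mul1r ler_nat.
have ptc k z : {for z, continuous (pt k)}.
  apply: cvgD; first exact: cvg_cst.
  by apply: cvgZr; apply: cvgB; [exact: cvg_id|exact: cvg_cst].
pose q k (z : V) := cmul (cconj (h (pt k z))) (h (pt k.+1 z)).
have q0 k z : (k < n)%N -> D z -> 0 < (q k z).1.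
  move=> kn Dz; apply: Hd; [exact: ptD (ltnW kn) Dz|exact: ptD|].
  rewrite /pt opprD addrACA subrr add0r -scalerBl.
  rewrite -[k.+1]addn1 natrD.
  have -> : k%:R / n%:R - (k%:R + 1) / n%:R = - n%:R^-1 :> R by lra.
  rewrite normrZ normrN gtr0_norm ?invr_gt0//.
  rewrite mulrC ltr_pdivrMr//.
  apply: (@le_lt_trans _ _ ((`|M| + 1) * 2)); last by rewrite -ltr_pdivrMl// mulrC.
  apply: le_trans (ler_normB _ _) _.
  by have := HM z Dz; have := HM p Dp; lra.
have uq k z : (k < n)%N -> D z -> unitv (q k z).
  by move=> kn Dz; apply: unitv_cmul; [apply: unitv_cconj|]; apply: uh;
    apply: ptD => //; apply: ltnW.
have [t0 ht0] := unitv_arg (uh _ Dp).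
pose T (m : nat) (z : V) := t0 + \sum_(k < m) asin (q k z).2.
have TP m z : (m <= n)%N -> D z -> {for z, continuous (T m)} /\ h (pt m z) = expi (T m z).
  move=> + Dz; elim: m => [_|m IH mn].
    split.
      rewrite (_ : T 0%N = cst t0); first exact: cvg_cst.
      by apply/funext => y; rewrite /T big_ord0 addr0.
    by rewrite /pt mul0r scale0r addr0 /T big_ord0 addr0.
  have [cT hT] := IH (ltnW mn).
  have TS : T m.+1 = (fun y => T m y + asin (q m y).2).
    by apply/funext => y; rewrite /T big_ord_recr /= addrA.
  split.
    rewrite TS; apply: (@cvgD _ R^o) => //.
    apply: asin_continuous; [|exact: uq|exact: q0].
    have hc k : (k <= n)%N -> {for z, continuous (fun y => h (pt k y))}.
      move=> kn; apply: (@continuous_comp _ _ _ (pt k) h); first exact: ptc.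
      by apply: ch; exact: ptD.
    by apply: cmul_continuous; [apply: cconj_continuous|]; apply: hc => //; apply: ltnW.
  rewrite TS expiD -hT expi_asin; [|exact: uq|exact: q0].
  rewrite /q; have := uh _ (ptD _ _ (ltnW mn) Dz); have := uh _ (ptD _ _ mn Dz).
  move=> /unitv_arg[s ->] /unitv_arg[s' ->].
  by rewrite -expiN -!expiD; congr expi; ring.
exists (T n) => z Dz; have [cT hT] := TP n z (leqnn _) Dz; split => //.
by rewrite -hT /pt divff ?gt_eqF// scale1r addrC subrK.
Qed.

End Lifting.

(** * Directions from a point of the plane and winding around it *)

Section Directions.
Variable R : realType.
Implicit Types (x y z p : R * R).

Definition dir x z : R * R :=
  let n := Num.sqrt ((z.1 - x.1) ^+ 2 + (z.2 - x.2) ^+ 2) in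
  ((z.1 - x.1) / n, (z.2 - x.2) / n).

Lemma sqdist_gt0 x z : z != x -> 0 < (z.1 - x.1) ^+ 2 + (z.2 - x.2) ^+ 2.
Proof.
case: x z => [a b] [c d] /=; rewrite xpair_eqE negb_and.
rewrite -(subr_eq0 c) -(subr_eq0 d) => /orP[]; rewrite -sqrf_eq0 => h.
  by rewrite ltr_wpDr ?sqr_ge0// lt_def h sqr_ge0.
by rewrite ltr_wpDl ?sqr_ge0// lt_def h sqr_ge0.
Qed.

Lemma unitv_dir x z : z != x -> unitv (dir x z).
Proof.
move=> /sqdist_gt0; set s := (X in 0 < X) => s0.
rewrite /unitv /dir /= -/s !expr_div_n -mulrDl sqr_sqrtr ?ltW// divff//.
by rewrite gt_eqF.
Qed.

Lemma dir_continuous x z : z != x -> {for z, continuous (dir x)}.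
Proof.
move=> /sqdist_gt0 s0.
have c1 : {for z, continuous (fun y : R * R => y.1 - x.1)}.
  by apply: (@cvgB _ R^o); [exact: cvg_fst|exact: cvg_cst].
have c2 : {for z, continuous (fun y : R * R => y.2 - x.2)}.
  by apply: (@cvgB _ R^o); [exact: cvg_snd|exact: cvg_cst].
have cn : {for z, continuous (fun y : R * R =>
    (Num.sqrt ((y.1 - x.1) ^+ 2 + (y.2 - x.2) ^+ 2))^-1)}.
  apply: (@cvgV R); first by rewrite gt_eqF// sqrtr_gt0.
  apply: (@continuous_comp _ _ _ (fun y : R * R => (y.1 - x.1) ^+ 2 + (y.2 - x.2) ^+ 2)
    Num.sqrt); last exact: sqrt_continuous.
  by apply: (@cvgD _ R^o); apply: cvgM.
by apply/cvg_pairP; split => /=; apply: cvgM.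
Qed.

Lemma dir_polar x (r t : R) : 0 < r -> dir x (x + r *: expi t) = expi t.
Proof.
move=> r0; rewrite /dir /expi /= ![_ + _ - _]addrAC !subrr !add0r.
rewrite ![r *: _]/(r * _).
rewrite !exprMn -mulrDr cos2Dsin2 mulr1 sqrtr_sqr gtr0_norm//.
by congr (_, _); rewrite mulrC mulrA mulVf ?mul1r// gt_eqF.
Qed.

(** The norm is the sup norm. In a coordinate where [z] is at least [5 e] away from [p], the product
    of the differences is at least [16 e^2]; in the other one it is at least [- e^2]. So the inner
    product is positive. *)
Lemma dir_close x y z p (e : R) : 0 < e -> `|x - p| <= e -> `|y - p| <= e ->
  5 * e <= `|z - p| -> 0 < (cmul (dir x z) (cconj (dir y z))).1.
Proof.
move=> e0 xp yp zp.
have zx : z != x by apply/eqP => zx; move: zp; rewrite zx; lra.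
have zy : z != y by apply/eqP => zy; move: zp; rewrite zy; lra.
rewrite /cmul /cconj /dir /=.
have ninv (u : R) : 0 < u -> 0 < (Num.sqrt u)^-1 by rewrite invr_gt0 sqrtr_gt0.
have := ninv _ (sqdist_gt0 zy); have := ninv _ (sqdist_gt0 zx).
set s := _^-1 => s0; set s' := _^-1 => s0'.
rewrite [X in 0 < X](_ : _ = s * s' *
  ((z.1 - x.1) * (z.1 - y.1) + (z.2 - x.2) * (z.2 - y.2))); last by ring.
apply: mulr_gt0; first exact: mulr_gt0.
move: xp yp zp; rewrite !prod_normE !ge_max le_max /=.
rewrite !ler_norml => /andP[/andP[a1 a2] /andP[a3 a4]] /andP[/andP[b1 b2] /andP[b3 b4]] zp.
set w1 := z.1 - p.1 in zp *; set w2 := z.2 - p.2 in zp *.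
set u1 := x.1 - p.1 in a1 a2; set u2 := x.2 - p.2 in a3 a4.
set v1 := y.1 - p.1 in b1 b2; set v2 := y.2 - p.2 in b3 b4.
rewrite (_ : z.1 - x.1 = w1 - u1); last by rewrite /w1 /u1; ring.
rewrite (_ : z.1 - y.1 = w1 - v1); last by rewrite /w1 /v1; ring.
rewrite (_ : z.2 - x.2 = w2 - u2); last by rewrite /w2 /u2; ring.
rewrite (_ : z.2 - y.2 = w2 - v2); last by rewrite /w2 /v2; ring.
have key (w u v : R) : - e <= u -> u <= e -> - e <= v -> v <= e ->
    - (e ^+ 2) <= (w - u) * (w - v) /\
    (5 * e <= `|w| -> 16 * e ^+ 2 <= (w - u) * (w - v)).
  move=> h1 h2 h3 h4; split.
    suff : (w - u) * (w - v) >= - ((u - v) / 2) ^+ 2 by nra.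
    have := sqr_ge0 (w - (u + v) / 2); nra.
  by rewrite ler_normr => /orP[] h; nra.
have [k1 k1'] := key w1 u1 v1 a1 a2 b1 b2.
have [k2 k2'] := key w2 u2 v2 a3 a4 b3 b4.
by case/orP: zp => [/k1'|/k2'] ?; nra.
Qed.

Lemma continuous_glue (T U : topologicalType) (f g h : T -> U) (z : T) :
  {for z, continuous f} -> {for z, continuous g} -> f z = g z ->
  (forall w, h w = f w \/ h w = g w) -> {for z, continuous h}.
Proof.
move=> cf cg fg hfg W.
have -> : h z = f z by case: (hfg z) => ->.
move=> WW; have Wf := cf _ WW; rewrite fg in WW; have Wg := cg _ WW.
rewrite /nbhs /=; near=> w.
have wf : W (f w) by near: w.
have wg : W (g w) by near: w.
by rewrite /preimage /=; case: (hfg w) => ->.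
Unshelve. all: by end_near. Qed.

Lemma compact_square p (r : R) : compact [set z : R * R | `|z - p| <= r].
Proof.
rewrite (_ : mkset _ = `[p.1 - r, p.1 + r]%classic `*` `[p.2 - r, p.2 + r]%classic).
  by apply: compact_setX; exact: segment_compact.
apply/seteqP; split => -[a b] /=; rewrite !in_itv/= prod_normE ge_max /= !ler_norml.
  by move=> /andP[/andP[? ?] /andP[? ?]]; split; apply/andP; split; lra.
by move=> [/andP[? ?] /andP[? ?]]; apply/andP; split; apply/andP; split; lra.
Qed.

(* The function equal to k on O and to e^(iG) dir_x^(-c) elsewhere is continuous on
   the whole square, hence has an argument there; on a circle around x it would
   make c times the polar angle single-valued. *)
Lemma winding_eq0 p (r : R) (O : set (R * R)) x (c : int) (G : R * R -> R)
    (k : R * R -> R * R) :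
  open O -> O x -> `|x - p| < r / 8 ->
  (forall z, `|z - p| <= r -> {for z, continuous G}) ->
  (forall z, `|z - p| <= r -> closure O z -> {for z, continuous k} /\ unitv (k z)) ->
  (forall z, `|z - p| <= r -> closure O z -> ~ O z \/ r / 8 <= `|z - p| ->
    cmul (cpow (dir x z) c) (k z) = expi (G z)) ->
  c = 0.
Proof.
move=> oO Ox xp cG hk hG.
have r0 : 0 < r by have := normr_ge0 (x - p); lra.
pose D := [set z : R * R | `|z - p| <= r].
pose h2 z := cmul (expi (G z)) (cpow (dir x z) (- c)).
have cG_k z t s : k z = expi s -> dir x z = expi t ->
    cmul (cpow (dir x z) c) (k z) = expi (G z) -> k z = h2 z.
  move=> ks ds; rewrite /h2 ds ks !expi_cpow -!expiD => e.
  by rewrite [RHS]expiD -e -expiD; congr expi; rewrite intrN; ring.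
pose H z := if `[< O z >] then k z else h2 z.
have h2c z : D z -> z != x -> {for z, continuous h2}.
  move=> Dz zx; apply: cmul_continuous; first by apply: expi_continuous; exact: cG.
  by apply: cpow_continuous; exact: dir_continuous.
have neq_x z : ~ O z -> z != x by move=> nO; apply/eqP => zx; apply: nO; rewrite zx.
have Hc z : D z -> {for z, continuous H}.
  move=> Dz; have [Oz|nOz] := pselect (O z).
    have HE : H z = k z by rewrite /H asboolT.
    rewrite /prop_for /continuous_at HE.
    apply: (@cvg_trans _ (k @ z)); last by have [] := hk z Dz (subset_closure Oz).
    apply: near_eq_cvg; near=> y; rewrite /H asboolT//.
    by near: y; exact: (open_nbhs_nbhs (conj oO Oz)).
  have HE : H z = h2 z by rewrite /H asboolF.
  have zx := neq_x _ nOz.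
  have [clz|nclz] := pselect (closure O z); last first.
    rewrite /prop_for /continuous_at HE.
    apply: (@cvg_trans _ (h2 @ z)); last exact: h2c.
    apply: near_eq_cvg; near=> y; rewrite /H asboolF//.
    suff : (~` closure O) y by apply: contra_not; exact: subset_closure.
    near: y; apply: (@open_nbhs_nbhs _ _ (~` closure O)); split => //.
    by apply: closed_openC; exact: closed_closure.
  (* At a boundary point of [O] the values of [k] and [h2] coincide by [hG], so the two pieces
     glue. *)
  have [kc ku] := hk z Dz clz.
  apply: (continuous_glue kc (h2c _ Dz zx)).
    have [t tE] := unitv_arg (unitv_dir zx); have [s sE] := unitv_arg ku.
    by apply: cG_k sE tE _; apply: hG => //; left.
  by move=> y; rewrite /H; case: asboolP => _; [left|right].
have uH z : D z -> unitv (H z).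
  move=> Dz; rewrite /H; case: asboolP => Oz.
    by have [] := hk z Dz (subset_closure Oz).
  apply: unitv_cmul; first exact: unitv_expi.
  by apply: unitv_cpow; apply: unitv_dir; exact: neq_x.
have Dp : D p by rewrite /D /= subrr normr0 ltW.
have star z (t : R) : D z -> 0 <= t <= 1 -> D (p + t *: (z - p)).
  move=> Dz /andP[t0 t1]; rewrite /D /= addrAC subrr add0r normrZ ger0_norm//.
  by apply: le_trans Dz; rewrite ler_piMl.
have [T HT] := starshaped_arg (@compact_square p r) Dp star Hc uH.
(* The circle of radius [r / 2] about [x] lies in the square. It stays at sup distance at least
   [r / 4] from [x], hence [r / 8] from [p], so that [k] and [h2] agree on it wherever it meets the
   closure of [O]. *)
pose zt t : R * R := x + (r / 2) *: expi t.
have r20 : 0 < r / 2 by rewrite divr_gt0.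
have zx t : `|zt t - x| = r / 2 * Num.max `|cos t| `|sin t|.
  by rewrite /zt addrAC subrr add0r normrZ gtr0_norm// prod_normE.
have cs1 (t : R) : Num.max `|cos t| `|sin t| <= 1.
  by rewrite ge_max cos_max sin_max.
have cs2 (t : R) : 1 / 2 <= Num.max `|cos t| `|sin t|.
  rewrite le_max; have := cos2Dsin2 t.
  rewrite -[cos t ^+ 2]real_normK ?num_real// -[sin t ^+ 2]real_normK ?num_real//.
  have [//|h1] := leP (1 / 2) `|cos t| => e /=.
  by rewrite leNgt; apply/negP => h2'; have := normr_ge0 (cos t);
    have := normr_ge0 (sin t); nra.
have zp1 t : `|zt t - p| <= r.
  rewrite (_ : zt t - p = (zt t - x) + (x - p)); last by rewrite addrA subrK.
  apply: le_trans (ler_normD _ _) _; rewrite zx.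
  by have := cs1 t; nra.
have zp2 t : r / 8 <= `|zt t - p|.
  have : `|zt t - x| <= `|zt t - p| + `|x - p|.
    rewrite (_ : zt t - x = (zt t - p) - (x - p)); last by rewrite opprB addrA subrK.
    exact: ler_normB.
  by rewrite zx; have := cs2 t; nra.
have Hzt t : expi (T (zt t)) = expi (G (zt t) - c%:~R * t).
  have [_ <-] := HT _ (zp1 t).
  have dE : dir x (zt t) = expi t by exact: dir_polar.
  have h2E : h2 (zt t) = expi (G (zt t) - c%:~R * t).
    by rewrite /h2 dE expi_cpow -expiD intrN mulNr.
  rewrite -h2E /H; case: asboolP => // Oz.
  have clO := subset_closure Oz.
  have [_ /unitv_arg[s sE]] := hk _ (zp1 t) clO.
  by apply: cG_k sE dE _; apply: hG => //; right.
(* [psi] is continuous with values in the multiples of [2 pi], yet it changes by [2 pi c] over one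
   turn. If [c] were nonzero, [psi 0 + pi] or [psi 0 - pi] would be a value by the intermediate
   value theorem, although its cosine is -1. *)
pose psi t := T (zt t) - G (zt t) + c%:~R * t.
have psiE t : cos (psi t) = 1.
  suff : expi (psi t) = expi 0 by rewrite /expi cos0 => -[].
  rewrite /psi -addrA expiD Hzt -expiD; congr expi; ring.
have ztc : continuous zt.
  move=> t; apply: cvgD; first exact: cvg_cst.
  apply: cvgZr; exact: expi_continuous.
have psic : continuous psi.
  move=> t; apply: (@cvgD _ R^o).
    apply: (@cvgB _ R^o).
      by apply: (continuous_comp (ztc t)); have [] := HT _ (zp1 t).
    by apply: (continuous_comp (ztc t)); apply: cG; exact: zp1.
  by apply: (@cvgM R); [exact: cvg_cst|exact: cvg_id].
have pi0 := @pi_gt0 R.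
have zt2pi : zt (pi *+ 2) = zt 0.
  by rewrite /zt /expi cos2pi sin2pi cos0 sin0.
have psi2pi : psi (pi *+ 2) = psi 0 + c%:~R * (pi *+ 2).
  by rewrite /psi zt2pi mulr0 addr0.
have ivt v : Num.min (psi 0) (psi (pi *+ 2)) <= v <= Num.max (psi 0) (psi (pi *+ 2)) ->
    cos v = 1.
  have pi20 : 0 <= pi *+ 2 :> R by rewrite mulrn_wge0// ltW.
  move=> /(IVT pi20 (continuous_subspaceT psic))[t _ <-]; exact: psiE.
apply/eqP/negPn/negP => c0.
have /orP[cp|cn] : (1 <= c) || (c <= -1) by case: c c0 {hG cG_k h2 h2c H Hc uH HT Hzt psi psiE psic psi2pi ivt} => -[|n].
  have : cos (psi 0 + pi) = 1.
    apply: ivt; rewrite psi2pi ge_min le_max mulr2n.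
    have : 1 <= c%:~R :> R by rewrite -[1]/(1%:~R) ler_int.
    by move=> cR; apply/andP; split; apply/orP; [left|right]; nra.
  rewrite cosDpi psiE => h; lra.
have : cos (psi 0 - pi) = 1.
  apply: ivt; rewrite psi2pi ge_min le_max mulr2n.
  have : c%:~R <= -1 :> R by rewrite -[-1]/((-1)%:~R) ler_int.
  by move=> cR; apply/andP; split; apply/orP; [right|left]; nra.
rewrite cosB cospi sinpi psiE => h; lra.
Unshelve. all: by end_near. Qed.

End Directions.

Section Inverse.
(** A continuous injection of a compact set into a Hausdorff space is closed: the preimage of a
    closed set under [g] is, within the image, the image of a compact set. This moves a function of
    the arc parameter to the arc itself. *)
Lemma within_image_inverse (T : ptopologicalType) (U W : topologicalType) (K : set T)
    (f : T -> U) (s : T -> W) : hausdorff_space U ->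
  compact K -> {within K, continuous f} -> {in K &, injective f} ->
  {within K, continuous s} ->
  exists g : U -> W, {within f @` K, continuous g} /\ forall t, K t -> g (f t) = s t.
Proof.
move=> hU cK cf fi cs.
pose inv z := get [set t | K t /\ f t = z].
have invE t : K t -> inv (f t) = t.
  move=> Kt; have [Ki] : [set t' | K t' /\ f t' = f t] (inv (f t)) by apply: (@getI _ _ t).
  by apply: fi; rewrite inE.
exists (s \o inv); split => [|t Kt]; last by rewrite /= invE.
apply/continuous_closedP => C cC; apply/closed_subspaceP.
have /continuous_closedP/(_ C cC)/closed_subspaceP[V cV VE] := cs.
exists (f @` (K `&` V)).
  apply: compact_closed => //; apply: continuous_compact.
    by apply: continuous_subspaceW cf => x [].
  exact: compact_closedI.
apply/seteqP; split => z [].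
  move=> [t [Kt Vt] <-] ft; split => //; change (C (s (inv (f t)))); rewrite invE//.
  have : (V `&` K) t by []; by rewrite VE => -[].
move=> Ct [t Kt tz]; have {}Ct : C (s (inv z)) by [].
move: Ct; rewrite -tz invE// => Ct; split; last by exists t.
exists t => //; have : (from_subspace K s @^-1` C `&` K) t by [].
by rewrite -VE => -[Vt _]; split.
Qed.
End Inverse.

(** * An arc in the plane is locally two-sided *)

Section Arc.
Variable R : realType.

(* Choose x_i in O_i very close to p = alpha t0, and let d_i be the direction from x_i.
   The quotients d_1/d_2 and d_2/d_3 have principal arguments far from p and
   arguments along the arc near p; at each of the two points where these regions
   meet the arguments differ by a multiple of 2 pi. Only one integer has to vanish
   for a combination f = (d_1/d_2)^ca (d_2/d_3)^cb to have an argument on the whole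
   arc and away from p, so (ca, cb) can be taken nonzero; extending this argument
   with Tietze, winding_eq0 in O_1 and O_3 gives ca = cb = 0. *)
Lemma arc_two_sided (alpha : R -> R * R) (a b t0 r : R) (O1 O2 O3 : set (R * R)) :
  a < t0 < b -> {within `[a, b], continuous alpha} ->
  {in `[a, b] &, injective alpha} -> 0 < r ->
  open O1 -> open O2 -> open O3 ->
  O1 `&` O2 = set0 -> O1 `&` O3 = set0 -> O2 `&` O3 = set0 ->
  alpha @` `[a, b] `&` (O1 `|` O2 `|` O3) = set0 ->
  (forall z, `|z - alpha t0| < r -> (O1 `|` O2 `|` O3 `|` alpha @` `[a, b]) z) ->
  closure O1 (alpha t0) -> closure O2 (alpha t0) -> closure O3 (alpha t0) -> False.
Proof.
move=> /andP[at0 t0b] calpha ialpha r0 oO1 oO2 oO3 O12 O13 O23 alphaO cover cl1 cl2 cl3.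
pose p := alpha t0; pose rad := r / 2.
have rad0 : 0 < rad by rewrite divr_gt0.
have calphaP t : a < t < b -> {for t, continuous alpha}.
  move=> tab; have tin : t \in `]a, b[ by rewrite in_itv.
  have : {within `]a, b[, continuous alpha}.
    by apply: continuous_subspaceW calpha; exact: subset_itv_oo_cc.
  by rewrite continuous_open_subspace; [apply; rewrite inE|exact: interval_open].
have [eta [eta0 aeta etab etaP]] : exists eta, [/\ 0 < eta, a < t0 - eta, t0 + eta < b &
    forall t, `|t0 - t| <= eta -> `|alpha t - p| < rad / 8].
  have /cvgrPdist_lt/(_ (rad / 8)) H := calphaP t0 (introT andP (conj at0 t0b)).
  have [|e /= e0 He] := (nbhs_ballP t0 _).1 (H _); first by rewrite divr_gt0.
  pose eta := Num.min (e / 2) (Num.min ((t0 - a) / 2) ((b - t0) / 2)).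
  have eta0 : 0 < eta by rewrite !lt_min !divr_gt0// subr_gt0.
  have h1 : eta <= e / 2 by rewrite ge_min lexx.
  have h2 : eta <= (t0 - a) / 2 by rewrite !ge_min lexx orbT.
  have h3 : eta <= (b - t0) / 2 by rewrite !ge_min lexx !orbT.
  exists eta; split => //; [lra|lra|move=> t ht].
  by rewrite distrC; apply: He; rewrite -ball_normE /=; lra.
pose tm := t0 - eta; pose tp := t0 + eta.
(* These are the parameters near [t0] and far from it. They share only [tm] and [tp], where the two
   kinds of arguments have to be compared. *)
pose K1 := `[tm, tp]%classic; pose K2 := `[a, tm]%classic `|` `[tp, b]%classic.
have K1ab : K1 `<=` `[a, b]%classic.
  move=> t; rewrite /K1 /tm /tp /= !in_itv/= => /andP[? ?]; apply/andP; split; lra.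
have K2ab : K2 `<=` `[a, b]%classic.
  move=> t; rewrite /K2 /tm /tp /= !in_itv/= => -[] /andP[? ?]; apply/andP; split; lra.
have K12 : `[a, b]%classic `<=` K1 `|` K2.
  move=> t; rewrite /K1 /K2 /= !in_itv/= => /andP[at' tb].
  have [|] := leP t tm; first by move=> ?; right; left; apply/andP.
  have [|] := leP t tp; first by move=> ? ?; left; apply/andP; split=> //; exact: ltW.
  by move=> *; right; right; apply/andP; split => //; exact: ltW.
have K12E t : K1 t -> K2 t -> t = tm \/ t = tp.
  rewrite /K1 /K2 /= !in_itv/= => /andP[? ?] [] /andP[? ?].
    by left; apply/eqP; rewrite eq_le; apply/andP.
  by right; apply/eqP; rewrite eq_le; apply/andP.
have K1m : K1 tm by rewrite /K1 /= in_itv/= lexx /tm /tp; lra.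
have K1p : K1 tp by rewrite /K1 /= in_itv/= lexx /tm /tp andbT; lra.
have K1t0 : K1 t0 by rewrite /K1 /= in_itv/= /tm /tp; apply/andP; split; lra.
have K2m : K2 tm by left; rewrite /= in_itv/= lexx /tm andbT ltW.
have K2p : K2 tp by right; rewrite /= in_itv/= lexx /tp ltW.
have hRR : hausdorff_space (R * R)%type by exact: norm_hausdorff.
have cK1 : compact K1 by exact: segment_compact.
have cK2 : compact K2 by apply: compactU; exact: segment_compact.
pose Y1 := alpha @` K1; pose A2 := alpha @` K2.
have cY1 : closed Y1.
  apply: compact_closed => //; apply: continuous_compact cK1.
  exact: continuous_subspaceW calpha.
have cA2 : closed A2.
  apply: compact_closed => //; apply: continuous_compact cK2.
  exact: continuous_subspaceW calpha.
have A2p : ~ A2 p.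
  move=> [t K2t /ialpha tt0].
  have {}tt0 : t = t0.
    by apply: tt0; [have := K2ab _ K2t|have := K1ab _ K1t0].
  have := K12E t0 K1t0; rewrite -{1}tt0 => /(_ K2t)[]; rewrite /tm /tp; lra.
have [rho rho0 rhoP] : exists2 rho, 0 < rho & forall z, A2 z -> rho <= `|z - p|.
  have : nbhs p (~` A2) by apply: open_nbhs_nbhs; split => //; exact: closed_openC.
  move=> /nbhs_ballP[e /= e0 He]; exists e => // z Az.
  rewrite leNgt; apply/negP => zp; apply: (He z) => //.
  by rewrite -ball_normE /= distrC.
(* The factor 5 is that of [dir_close]: two points within [e] of [p] see any point of the far arc,
   or any point at distance at least [rad / 8] from [p], in directions less than a right angle
   apart. *)
pose e := Num.min rho (rad / 8) / 5.
have rad80 : 0 < rad / 8 by rewrite divr_gt0.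
have e0 : 0 < e by rewrite divr_gt0// lt_min rho0.
have e5 : 5 * e = Num.min rho (rad / 8) by rewrite /e; field.
have erho : 5 * e <= rho by rewrite e5 ge_min lexx.
have erad : 5 * e <= rad / 8 by rewrite e5 ge_min lexx orbT.
have pick (O : set (R * R)) : closure O p -> exists2 x, O x & `|x - p| < e.
  move=> /(_ (ball p e) (nbhsx_ballx _ _ e0))[x [Ox]].
  by rewrite -ball_normE /= distrC => xp; exists x.
have [x1 O1x1 x1p] := pick _ cl1.
have [x2 O2x2 x2p] := pick _ cl2.
have [x3 O3x3 x3p] := pick _ cl3.
have notarc z t : (O1 `|` O2 `|` O3) z -> `[a, b]%classic t -> alpha t != z.
  move=> Oz abt; apply/eqP => tz.
  suff : (alpha @` `[a, b] `&` (O1 `|` O2 `|` O3)) z by rewrite alphaO.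
  by split => //; exists t.
pose Y2 := A2 `|` [set z | rad / 8 <= `|z - p|].
have cY2 : closed Y2.
  apply: closedU => //.
  rewrite (_ : mkset _ = (fun z => `|z - p|) @^-1` [set x | rad / 8 <= x])//.
  apply: preimage_closed; last exact: closed_ge.
  move=> z _; apply: (@continuous_comp _ _ _ (fun z : R * R => z - p) Num.norm).
    by apply: cvgB; [exact: cvg_id|exact: cvg_cst].
  exact: norm_continuous.
have Y2e z : Y2 z -> 5 * e <= `|z - p|.
  by move=> [/rhoP|/= ] ?; lra.
pose q (x y z : R * R) := cmul (dir x z) (cconj (dir y z)).
have q0 x y z : `|x - p| < e -> `|y - p| < e -> Y2 z -> 0 < (q x y z).1.
  by move=> xp yp /Y2e zp; exact: (dir_close e0 (ltW xp) (ltW yp) zp).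
have qu x y z : z != x -> z != y -> unitv (q x y z).
  by move=> zx zy; apply: unitv_cmul; [|apply: unitv_cconj]; exact: unitv_dir.
have qc x y z : z != x -> z != y -> {for z, continuous (q x y)}.
  by move=> zx zy; apply: cmul_continuous; [|apply: cconj_continuous]; exact: dir_continuous.
have Y2n x z : `|x - p| < e -> Y2 z -> z != x.
  by move=> xp /Y2e zp; apply/eqP => zx; move: zp; rewrite zx; lra.
have argK1 x y : (O1 `|` O2 `|` O3) x -> (O1 `|` O2 `|` O3) y ->
    exists T : R -> R, forall t, K1 t -> {for t, continuous T} /\ q x y (alpha t) = expi (T t).
  move=> Ox Oy; apply: (@starshaped_arg R R^o K1 t0 (fun t => q x y (alpha t))) => //.
  - move=> z t; rewrite /K1 /tm /tp /= !in_itv/= -[t *: _]/(t * _).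
    by move=> /andP[? ?] /andP[? ?]; apply/andP; split; nra.
  - move=> t K1t; apply: (@continuous_comp _ _ _ alpha (q x y)).
      apply: calphaP; move: K1t; rewrite /K1 /tm /tp /= in_itv/= => /andP[? ?].
      by apply/andP; split; lra.
    by apply: qc; apply: notarc => //; exact: K1ab.
  - by move=> t K1t; apply: qu; apply: notarc => //; exact: K1ab.
have O123x1 : (O1 `|` O2 `|` O3) x1 by left; left.
have O123x2 : (O1 `|` O2 `|` O3) x2 by left; right.
have O123x3 : (O1 `|` O2 `|` O3) x3 by right.
have [th12 th12P] := argK1 x1 x2 O123x1 O123x2.
have [th23 th23P] := argK1 x2 x3 O123x2 O123x3.
pose g12 z := asin (q x1 x2 z).2; pose g23 z := asin (q x2 x3 z).2.
have g12P z : Y2 z -> q x1 x2 z = expi (g12 z).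
  by move=> Yz; rewrite /g12 expi_asin//; [apply: qu; exact: Y2n|exact: q0].
have g23P z : Y2 z -> q x2 x3 z = expi (g23 z).
  by move=> Yz; rewrite /g23 expi_asin//; [apply: qu; exact: Y2n|exact: q0].
have Y2a t : K2 t -> Y2 (alpha t) by move=> K2t; left; exists t.
have jump12 t : K1 t -> K2 t -> exists n : int, th12 t = g12 (alpha t) + n%:~R * (pi *+ 2).
  by move=> K1t K2t; apply: expi_inj; rewrite -g12P ?(th12P _ K1t).2//; exact: Y2a.
have jump23 t : K1 t -> K2 t -> exists n : int, th23 t = g23 (alpha t) + n%:~R * (pi *+ 2).
  by move=> K1t K2t; apply: expi_inj; rewrite -g23P ?(th23P _ K1t).2//; exact: Y2a.
have [n1 n1E] := jump12 _ K1m K2m; have [n2 n2E] := jump12 _ K1p K2p.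
have [m1 m1E] := jump23 _ K1m K2m; have [m2 m2E] := jump23 _ K1p K2p.
have [ca [cb [cab cab0]]] : exists ca cb : int, ca * (n2 - n1) + cb * (m2 - m1) = 0 /\
    ~ (ca = 0 /\ cb = 0).
  have [n0|n0] := eqVneq (n2 - n1) 0.
    by exists 1, 0; rewrite n0 mulr0 mul0r; split => // -[].
  exists (m2 - m1), (- (n2 - n1)); split; first by rewrite mulNr mulrC subrr.
  by move=> [_ /eqP]; rewrite oppr_eq0 (negbTE n0).
have cabR : ca%:~R * (n2%:~R - n1%:~R) + cb%:~R * (m2%:~R - m1%:~R) = 0 :> R.
  by rewrite -!intrB -!intrM -intrD cab.
(* [C] is the discrepancy of the combined arguments at [tm]; by the choice of [ca] and [cb] it is
   also the discrepancy at [tp]. *)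
pose C : R := (ca%:~R * n1%:~R + cb%:~R * m1%:~R) * (pi *+ 2).
pose s t := ca%:~R * th12 t + cb%:~R * th23 t - C.
pose g2 z := ca%:~R * g12 z + cb%:~R * g23 z.
have sm : s tm = g2 (alpha tm) by rewrite /s /g2 n1E m1E /C; ring.
have sp : s tp = g2 (alpha tp).
  rewrite /s /g2 n2E m2E /C.
  rewrite [LHS](_ : _ = ca%:~R * g12 (alpha tp) + cb%:~R * g23 (alpha tp) +
    (ca%:~R * (n2%:~R - n1%:~R) + cb%:~R * (m2%:~R - m1%:~R)) * (pi *+ 2)).
    by rewrite cabR mul0r addr0.
  ring.
pose f z := cmul (cpow (q x1 x2 z) ca) (cpow (q x2 x3 z) cb).
have fs t : K1 t -> f (alpha t) = expi (s t).
  move=> K1t; rewrite /f (th12P _ K1t).2 (th23P _ K1t).2 !expi_cpow -expiD.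
  rewrite /s [RHS]expiD.
  have -> : expi (- C) = expi 0.
    rewrite /C -mulNr -!intrM -intrD -intrN -expi_cpow.
    have -> : expi (pi *+ 2) = expi 0 :> R * R by rewrite /expi cos2pi sin2pi cos0 sin0.
    by rewrite expi_cpow mulr0.
  by rewrite -expiD addr0.
have fg2 z : Y2 z -> f z = expi (g2 z).
  by move=> Yz; rewrite /f g12P// g23P// !expi_cpow -expiD.
have scont t : K1 t -> {for t, continuous s}.
  move=> K1t; apply: (@cvgB _ R^o); last exact: cvg_cst.
  by apply: (@cvgD _ R^o); apply: cvgM; try exact: cvg_cst;
    [have [] := th12P _ K1t|have [] := th23P _ K1t].
have swithin : {within K1, continuous s}.
  by apply: continuous_in_subspaceT => t; rewrite inE; exact: scont.
have [G1 [G1c G1E]] : exists G1 : R * R -> R,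
    {within Y1, continuous G1} /\ forall t, K1 t -> G1 (alpha t) = s t.
  apply: (within_image_inverse hRR cK1 _ _ swithin).
    exact: continuous_subspaceW calpha.
  by move=> t t'; rewrite !inE => /K1ab h /K1ab h'; apply: ialpha.
pose g z := if `[< Y1 z >] then G1 z else g2 z.
have gY1 z : Y1 z -> g z = G1 z by move=> ?; rewrite /g asboolT.
(* The near arc stays within [rad / 8] of [p], so [Y1] and [Y2] meet only in the images of [tm] and
   [tp], where [s] and [g2] agree. *)
have gY2 z : Y2 z -> g z = g2 z.
  move=> Yz; rewrite /g; case: asboolP => // -[t K1t tz].
  have K2t : K2 t.
    case: Yz => [[t' K2t' t'z]|/=].
      have -> // : t = t'.
      by apply: ialpha; [exact: K1ab|exact: K2ab|rewrite tz].
    rewrite leNgt -tz etaP//; move: K1t; rewrite /K1 /tm /tp /= in_itv/= => /andP[? ?].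
    by rewrite ler_norml; apply/andP; split; lra.
  rewrite -tz G1E//.
  by have [->|->] := K12E t K1t K2t.
have gc : {within Y1 `|` Y2, continuous g}.
  apply: withinU_continuous => //.
    apply: (@subspace_eq_continuous _ _ _ G1) => //.
    by move=> z; rewrite inE => /gY1.
  apply: (@subspace_eq_continuous _ _ _ g2).
    by move=> z; rewrite inE => /gY2.
  apply: continuous_in_subspaceT => z; rewrite inE => Yz.
  apply: (@cvgD _ R^o); apply: cvgM; try exact: cvg_cst;
    (apply: asin_continuous; [apply: qc|apply: qu|apply: q0] => //; exact: Y2n).
(* Tietze extension is used in its bounded form: [s] is bounded on the compact [K1], and principal
   arguments are at most [pi / 2] in absolute value. *)
have [M M0 gM] : exists2 M, 0 < M & forall z, (Y1 `|` Y2) z -> `|g z| <= M.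
  have [M1 [_ /(_ (`|M1| + 1)) HM]] : bounded_set (s @` K1).
    by apply: (@compact_bounded _ R^o); exact: continuous_compact cK1.
  have {}HM t : K1 t -> `|s t| <= `|M1| + 1.
    move=> K1t; apply: HM; last by exists t.
    by apply: le_lt_trans (ler_norm _) _; rewrite ltrDl.
  pose M2 : R := `|ca%:~R| * (pi / 2) + `|cb%:~R| * (pi / 2).
  have M20 : 0 <= M2 by rewrite addr_ge0// mulr_ge0// divr_ge0// pi_ge0.
  have asin_bound u : unitv u -> `|asin u.2| <= pi / 2 :> R.
    rewrite /unitv => uu; have u1 : -1 <= u.2 <= 1 by apply/andP; split; nra.
    by rewrite ler_norml asin_geNpi2// asin_lepi2.
  have g2M z : Y2 z -> `|g2 z| <= M2.
    move=> Yz; apply: le_trans (ler_normD _ _) _; rewrite !normrM.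
    by apply: lerD; apply: ler_wpM2l => //; apply: asin_bound; apply: qu; exact: Y2n.
  exists (`|M1| + 1 + M2); first by have := normr_ge0 M1; lra.
  move=> z [Yz|Yz].
    by rewrite gY1//; case: Yz => t K1t <-; rewrite G1E//; have := HM _ K1t; lra.
  by rewrite gY2//; have := g2M _ Yz; have := normr_ge0 M1; lra.
have cY : closed (Y1 `|` Y2) by exact: closedU.
have [G [GE Gc _]] := continuous_bounded_extension pseudometric_normal cY M0 gc gM.
have fG z : (Y1 `|` Y2) z -> f z = expi (G z).
  move=> Yz; rewrite -GE ?inE//; case: Yz => Yz.
    by rewrite gY1//; case: Yz => t K1t <-; rewrite G1E// fs.
  by rewrite gY2// fg2.
have arcY z : (alpha @` `[a, b]) z -> (Y1 `|` Y2) z.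
  by move=> [t /K12[K1t|K2t] <-]; [left; exists t|right; left; exists t].
have Ynotx z x : (O1 `|` O2 `|` O3) x -> `|x - p| < e -> (Y1 `|` Y2) z -> z != x.
  move=> Ox xp [[t K1t <-]|Yz]; last exact: Y2n.
  by apply: notarc => //; exact: K1ab.
(* Expanded in the three directions, [f] is [d_1^ca d_2^(cb - ca) d_3^(- cb)]. *)
have fE z : (Y1 `|` Y2) z -> exists t1 t2 t3, [/\ dir x1 z = expi t1, dir x2 z = expi t2,
    dir x3 z = expi t3 & f z = expi (ca%:~R * t1 + (cb - ca)%:~R * t2 + (- cb)%:~R * t3)].
  move=> Yz.
  have [t1 t1E] := unitv_arg (unitv_dir (Ynotx _ _ O123x1 x1p Yz)).
  have [t2 t2E] := unitv_arg (unitv_dir (Ynotx _ _ O123x2 x2p Yz)).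
  have [t3 t3E] := unitv_arg (unitv_dir (Ynotx _ _ O123x3 x3p Yz)).
  exists t1, t2, t3; split => //.
  rewrite /f /q t1E t2E t3E -!expiN -!expiD !expi_cpow -expiD; congr expi.
  by rewrite intrB intrN; ring.
have cl_disj (O O' : set (R * R)) z : open O' -> O `&` O' = set0 -> closure O z -> ~ O' z.
  move=> oO' OO' clz O'z.
  have [y [Oy O'y]] := clz O' (open_nbhs_nbhs (conj oO' O'z)).
  by have : (O `&` O') y by []; rewrite OO'.
(* [app] is stated symmetrically so that it serves for [O1] and for [O3]. The factor [k] collects
   the other two directions: their base points lie in open sets disjoint from [O], so it is
   continuous on the closure of [O]. *)
have app (O O' O'' : set (R * R)) x x' x'' (c c' c'' : int) :
    open O -> open O' -> open O'' -> O x -> O' x' -> O'' x'' -> `|x - p| < e ->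
    O `&` O' = set0 -> O `&` O'' = set0 ->
    (forall z, (O1 `|` O2 `|` O3) z -> [\/ O z, O' z | O'' z]) ->
    (forall z, (Y1 `|` Y2) z -> exists t t' t'', [/\ dir x z = expi t, dir x' z = expi t',
      dir x'' z = expi t'' & f z = expi (c%:~R * t + c'%:~R * t' + c''%:~R * t'')]) ->
    c = 0.
  move=> oO oO' oO'' Ox O'x' O''x'' xp OO' OO'' Ocov fE'.
  have clx' z : closure O z -> z != x'.
    by move=> clz; apply/eqP => zx; apply: (cl_disj O O' z) => //; rewrite zx.
  have clx'' z : closure O z -> z != x''.
    by move=> clz; apply/eqP => zx; apply: (cl_disj O O'' z) => //; rewrite zx.
  apply: (@winding_eq0 R p rad O x c G
    (fun z => cmul (cpow (dir x' z) c') (cpow (dir x'' z) c''))) => //.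
  - by apply: lt_le_trans xp _; lra.
  - by move=> z _; exact: Gc.
  - move=> z _ clz; split.
      by apply: cmul_continuous; apply: cpow_continuous; apply: dir_continuous;
        [exact: clx'|exact: clx''].
    by apply: unitv_cmul; apply: unitv_cpow; apply: unitv_dir; [exact: clx'|exact: clx''].
  - move=> z zp clz Oz.
    have Yz : (Y1 `|` Y2) z.
      case: Oz => [nOz|]; last by right; right.
      have [|Oz|] := cover z; last exact: arcY.
        by apply: le_lt_trans zp _; rewrite /rad; lra.
      have [//|O'z|O''z] := Ocov z Oz.
        by exfalso; apply: (cl_disj O O' z).
      by exfalso; apply: (cl_disj O O'' z).
    have [t [t' [t'' [-> -> -> fz]]]] := fE' _ Yz.
    by rewrite -fG// fz !expi_cpow -!expiD addrA.
apply: cab0; split.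
  apply: (app O1 O2 O3 x1 x2 x3 ca (cb - ca) (- cb)) => //.
  by move=> z [[?|?]|?]; [apply: Or31|apply: Or32|apply: Or33].
apply/eqP; rewrite -oppr_eq0; apply/eqP.
apply: (app O3 O1 O2 x3 x1 x2 (- cb) ca (cb - ca)) => //; try by rewrite setIC.
  by move=> z [[?|?]|?]; [apply: Or32|apply: Or33|apply: Or31].
move=> z /fE[t1 [t2 [t3 [? ? ? fz]]]]; exists t3, t1, t2; split => //.
by rewrite fz; congr expi; ring.
Qed.

End Arc.

(** * Surfaces, drawn graphs and faces *)

Section PlaneConnected.
Variable R : realType.
Implicit Types (A : set (R * R)) (p : R * R).

Lemma convex_connected A :
  (forall x y (t : R), A x -> A y -> 0 <= t <= 1 -> A (x + t *: (y - x))) ->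
  connected A.
Proof.
move=> cA; have [->|/set0P[c Ac]] := eqVneq A set0; first exact: connected0.
pose seg y := (fun t : R => c + t *: (y - c)) @` `[0, 1].
have -> : A = \bigcup_(y in A) seg y.
  apply/seteqP; split => y.
    move=> Ay; exists y => //; exists 1; first by rewrite /= in_itv/= ler01 lexx.
    by rewrite scale1r addrC subrK.
  by move=> [z Az [t /=]]; rewrite in_itv/= => t01 <-; exact: cA.
apply: bigcup_connected.
  exists c => y Ay; exists 0; first by rewrite /= in_itv/= ler01 lexx.
  by rewrite scale0r addr0.
move=> y Ay; apply: connected_continuous_connected; first exact: segment_connected.
apply: continuous_subspaceT => t; apply: cvgD; first exact: cvg_cst.
exact: scalel_continuous.
Qed.

Lemma convex_comb_lt (a b r t : R) : a < r -> b < r -> 0 <= t -> t <= 1 ->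
  (1 - t) * a + t * b < r.
Proof.
move=> ar br; rewrite le_eqVlt => /predU1P[<- _|t0 t1].
  by rewrite subr0 mul1r mul0r addr0.
have : 0 < t * (r - b) by rewrite mulr_gt0// subr_gt0.
have : 0 <= (1 - t) * (r - a) by rewrite mulr_ge0// subr_ge0// ltW.
lra.
Qed.

Lemma ball_connected p (r : R) : connected (ball p r).
Proof.
apply: convex_connected => x y t; rewrite -ball_normE /= => xp yp /andP[t0 t1].
rewrite (_ : p - (x + t *: (y - x)) = (1 - t) *: (p - x) + t *: (p - y)).
  apply: le_lt_trans (ler_normD _ _) _; rewrite !normrZ !ger0_norm ?subr_ge0//.
  exact: convex_comb_lt.
rewrite scalerBl scale1r -addrA [- _ + _]addrC -scalerBr opprD addrA.
by rewrite (_ : p - y - (p - x) = - (y - x)) ?scalerN// !opprB addrC addrA subrK.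
Qed.

(** The ball is a square in the sup norm. Without its centre it is the union of four convex
    half-squares (right, top, left, bottom); adjacent ones overlap in a point such as
    [(p.1 + r / 2, p.2 + r / 2)]. *)
Lemma punctured_ball_connected p (r : R) : connected (ball p r `\ p).
Proof.
have [r0|r0] := leP r 0.
  rewrite (_ : ball p r `\ p = set0); first exact: connected0.
  apply/seteqP; split => // z [] + _; rewrite -ball_normE /=.
  by have := normr_ge0 (p - z); lra.
pose half (f : R * R -> R) := [set z : R * R | `|p.1 - z.1| < r /\ `|p.2 - z.2| < r /\ 0 < f z].
have half_conn (u v : R) : connected (half (fun z => u * (z.1 - p.1) + v * (z.2 - p.2))).
  apply: convex_connected => x y t [x1 [x2 x3]] [y1 [y2 y3]] /andP[t0 t1].
  have bnd (a b c : R) : `|a - b| < r -> `|a - c| < r -> `|a - (b + t * (c - b))| < r.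
    move=> ab ac; rewrite (_ : a - _ = (1 - t) * (a - b) + t * (a - c)); last by ring.
    apply: le_lt_trans (ler_normD _ _) _; rewrite !normrM (ger0_norm t0).
    rewrite (@ger0_norm _ (1 - t)) ?subr_ge0//.
    exact: convex_comb_lt.
  split; first exact: bnd.
  split; first exact: bnd.
  rewrite /= -![t *: _]/(t * _).
  set a := (X in 0 < X) in x3; set b := (X in 0 < X) in y3.
  rewrite [X in 0 < X](_ : _ = - ((1 - t) * (- a) + t * (- b))); last by rewrite /a /b; ring.
  by rewrite oppr_gt0; apply: convex_comb_lt; rewrite ?oppr_lt0.
have -> : ball p r `\ p =
    half (fun z => 1 * (z.1 - p.1) + 0 * (z.2 - p.2)) `|`
    half (fun z => 0 * (z.1 - p.1) + 1 * (z.2 - p.2)) `|`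
    half (fun z => (-1) * (z.1 - p.1) + 0 * (z.2 - p.2)) `|`
    half (fun z => 0 * (z.1 - p.1) + (-1) * (z.2 - p.2)).
  apply/seteqP; split.
    move=> [z1 z2] [] /=; rewrite -ball_normE /= prod_normE gt_max /= => /andP[h1 h2] /eqP zp.
    have : (z1 != p.1) || (z2 != p.2).
      rewrite -negb_and; apply: contra zp => /andP[/eqP -> /eqP ->].
      by rewrite -surjective_pairing.
    move=> /orP[]; rewrite neq_lt => /orP[] h.
    - by left; right; do 2 split => //=; lra.
    - by left; left; left; do 2 split => //=; lra.
    - by right; do 2 split => //=; lra.
    - by left; left; right; do 2 split => //=; lra.
  have sub u v : half (fun z => u * (z.1 - p.1) + v * (z.2 - p.2)) `<=` ball p r `\ p.
    move=> z [h1 [h2 h3]]; split.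
      by rewrite -ball_normE /= prod_normE gt_max h1.
    by move=> zp; move: h3; rewrite zp !subrr; lra.
  by move=> z [[[]|]|]; exact: sub.
have mem (u v a b : R) : -1 <= a -> a <= 1 -> -1 <= b -> b <= 1 -> 0 < u * a + v * b ->
    half (fun z => u * (z.1 - p.1) + v * (z.2 - p.2)) (p.1 + a * (r / 2), p.2 + b * (r / 2)).
  move=> a1 a2 b1 b2 uv; have bnd (c d : R) : -1 <= d -> d <= 1 -> `|c - (c + d * (r / 2))| < r.
    by move=> *; rewrite ltr_norml; apply/andP; split; nra.
  split; first exact: bnd.
  split; first exact: bnd.
  rewrite /= ![_ + _ - _]addrAC !subrr !add0r; nra.
apply: connectedU; last exact: half_conn.
  by exists (p.1 + 1 * (r / 2), p.2 + (-1) * (r / 2)); split;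
    [left; left|]; apply: mem; lra.
apply: connectedU; last exact: half_conn.
  by exists (p.1 + (-1) * (r / 2), p.2 + 1 * (r / 2)); split;
    [right|]; apply: mem; lra.
apply: connectedU; [|exact: half_conn|exact: half_conn].
by exists (p.1 + 1 * (r / 2), p.2 + 1 * (r / 2)); split; apply: mem; lra.
Qed.

End PlaneConnected.

Section SurfaceTopology.
Variables (R : realType) (S : topologicalType).
Hypothesis hS : connected_closed_surface R S.
Implicit Types (A N U : set S) (p : S).

Let hausS : hausdorff_space S. Proof. by have [] := hS. Qed.

Lemma surface_chart p : exists (U : set S) (f : S -> R * R) (g : R * R -> S),
  [/\ open U /\ U p, {in U, continuous f}, continuous g,
      (forall z, U (g z)) /\ cancel g f & {in U, cancel f g}].
Proof.
have [_ _ _ /(_ p)[U [oU Up [f [g [cf cg Ug gf fg]]]]]] := hS.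
by exists U, f, g; split => //; rewrite -continuous_open_subspace.
Qed.

(** Images of small squares under a chart inverse. Connectedness after deleting [p] is what excludes
    a vertex as an isolated obstruction in [edge_closed_faces]. *)
Lemma disc_nbhd p N : nbhs p N -> exists N', [/\ nbhs p N', N' `<=` N,
  connected N' & connected (N' `\ p)].
Proof.
move=> Np; have [U [f [g [[oU Up] cf cg [Ug gf] fg]]]] := surface_chart p.
have gfp : g (f p) = p by apply: fg; rewrite inE.
have /nbhs_ballP[r /= r0 rN] : nbhs (f p) (g @^-1` N) by apply: cg; rewrite gfp.
exists (g @` ball (f p) r); split.
- apply: (@filterS _ _ _ (U `&` f @^-1` ball (f p) r)).
    by move=> q [Uq fq]; exists (f q) => //; apply: fg; rewrite inE.
  apply: filterI; first exact: open_nbhs_nbhs.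
  by apply: cf; [rewrite inE|exact: nbhsx_ballx].
- by move=> _ [z /rN zN <-].
- apply: connected_continuous_connected; first exact: ball_connected.
  exact: continuous_subspaceT.
rewrite (_ : _ `\ p = g @` (ball (f p) r `\ f p)).
  apply: connected_continuous_connected; first exact: punctured_ball_connected.
  exact: continuous_subspaceT.
apply/seteqP; split => q.
  move=> [[z zr <-] gzp]; exists z => //; split => // zp.
  by apply: gzp; rewrite /= zp.
move=> [z [zr zp] <-]; split; first by exists z.
by move=> /= gzp; apply: zp; rewrite /= -gzp gf.
Qed.

Lemma open_connected_component A p : open A -> open (connected_component A p).
Proof.
move=> oA; rewrite openE => q Aq.
have NA : nbhs q A.
  by apply: open_nbhs_nbhs; split => //; exact: connected_component_sub Aq.
have [N [Nq NsA cN _]] := disc_nbhd NA.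
have Nqq := nbhs_singleton Nq; apply: filterS Nq; rewrite (same_connected_component Aq).
exact: connected_component_max Nqq NsA cN.
Qed.

Lemma closure_open_frontier A : open A -> closure A = A `|` frontier A.
Proof.
move=> /interior_id oA; rewrite /frontier oA.
apply/seteqP; split => q.
  by have [?|?] := pselect (A q); [left|right].
by move=> [|[]] //; exact: subset_closure.
Qed.

End SurfaceTopology.

Section DrawnGraph.
Variables (R : realType) (S : topologicalType).
Hypothesis hS : connected_closed_surface R S.
Variables (V : finType) (adj : rel V) (G : embedding R adj S).
Implicit Types (e : {set V}) (t : R) (W : set S).

Let hausS : hausdorff_space S. Proof. by have [] := hS. Qed.

(** The ends of [e] are included, so the set is closed and an inner point of [e] has a neighbourhood
    in which only [e] is drawn. *)
Definition rest_of_graph e : set S := range (vertex_point G) `|`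
  \bigcup_(e' in [set e' | e' \in edges adj /\ e' != e]) drawn_edge G e'.

Lemma closed_arc e t0 t1 : e \in edges adj -> 0 <= t0 -> t1 <= 1 ->
  closed (edge_arc G e @` `[t0, t1]).
Proof.
move=> eE t00 t11; apply: compact_closed => //; apply: continuous_compact; last first.
  exact: segment_compact.
apply: continuous_subspaceW (@edge_arc_continuous _ _ _ _ G _ eE) => t /=.
by rewrite !in_itv/= => /andP[? ?]; apply/andP; split; lra.
Qed.

Lemma closed_vertices : closed (range (vertex_point G)).
Proof.
apply: compact_closed => //; apply: finite_compact.
exact/finite_image/finite_finset.
Qed.

Lemma closed_drawn_edges (P : {set V} -> Prop) :
  closed (\bigcup_(e in [set e | e \in edges adj /\ P e]) drawn_edge G e).
Proof.
apply: closed_bigcup => [|e [eE _]]; first exact: finite_finset.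
exact: closed_arc.
Qed.

Lemma closed_rest_of_graph e : closed (rest_of_graph e).
Proof. by apply: closedU; [exact: closed_vertices|exact: closed_drawn_edges]. Qed.

Lemma closed_drawn_graph : closed (drawn_graph G).
Proof.
apply: closedU; first exact: closed_vertices.
rewrite (_ : mkset _ = [set e | e \in edges adj /\ True]).
  exact: closed_drawn_edges.
by apply/seteqP; split => e //= [].
Qed.

Lemma open_faces (f : set S) : faces G f -> open f.
Proof.
move=> [p _ ->]; apply: (open_connected_component hS).
by apply: closed_openC; exact: closed_drawn_graph.
Qed.

Lemma face_compl (f : set S) : faces G f -> f `<=` ~` drawn_graph G.
Proof. by move=> [p _ ->]; exact: connected_component_sub. Qed.

Lemma face_eq (f g : set S) p : faces G f -> faces G g -> f p -> g p -> f = g.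
Proof.
move=> [q _ ->] [q' _ ->] fp gp.
by rewrite (same_connected_component fp) (same_connected_component gp).
Qed.

Lemma face_of p : ~ drawn_graph G p -> exists2 f, faces G f & f p.
Proof.
move=> pG; exists (connected_component (~` drawn_graph G) p); first by exists p.
exact: connected_component_refl.
Qed.

Lemma edge_arc_inner e t : e \in edges adj -> 0 <= t <= 1 ->
  0 < t < 1 \/ range (vertex_point G) (edge_arc G e t).
Proof.
move=> eE /andP[t0 t1].
have ends s : s = 0 \/ s = 1 -> range (vertex_point G) (edge_arc G e s).
  move=> s01.
  suff : (vertex_point G @` [set v | v \in e]) (edge_arc G e s).
    by move=> [v _ <-]; exists v.
  by rewrite -(@edge_arc_ends _ _ _ _ G _ eE); case: s01 => ->; [left|right].
have [t0'|t0'|t0'] := ltgtP 0 t; [|lra|by right; apply: ends; left].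
have [t1'|t1'|t1'] := ltgtP t 1; [by left; apply/andP|lra|by right; apply: ends; right].
Qed.

Lemma drawn_edge_graph e : e \in edges adj -> drawn_edge G e `<=` drawn_graph G.
Proof. by move=> eE p ep; right; exists e. Qed.

Lemma inner_not_rest e t : e \in edges adj -> 0 < t < 1 ->
  ~ rest_of_graph e (edge_arc G e t).
Proof.
move=> eE t01.
have notv : ~ range (vertex_point G) (edge_arc G e t).
  move=> vt; suff : (edge_arc G e @` `]0, 1[ `&` range (vertex_point G)) (edge_arc G e t).
    by rewrite edge_arc_vertex.
  by split => //; exists t => //; rewrite /= in_itv.
case=> [//|[e' [e'E ee'] [s /=]]]; rewrite in_itv/= => s01 st.
have [s01'|] := edge_arc_inner e'E s01; last by rewrite st.
have : (edge_arc G e' @` `]0, 1[ `&` edge_arc G e @` `]0, 1[) (edge_arc G e t).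
  by split; [exists s|exists t] => //; rewrite /= in_itv.
by rewrite edge_arc_disjoint.
Qed.

Lemma graph_rest e : drawn_graph G `<=` rest_of_graph e `|` drawn_edge G e.
Proof.
move=> p [vp|[e' e'E pe']]; first by left; left.
have [<-|ee'] := eqVneq e' e; first by right.
by left; right; exists e'.
Qed.

(** A chart around the point turns a short piece of the edge into a plane arc, to which
    [arc_two_sided] applies. *)
Lemma edge_two_sided e t0 W1 W2 W3 : e \in edges adj -> 0 < t0 < 1 ->
  open W1 -> open W2 -> open W3 ->
  W1 `&` W2 = set0 -> W1 `&` W3 = set0 -> W2 `&` W3 = set0 ->
  W1 `|` W2 `|` W3 = ~` drawn_graph G ->
  closure W1 (edge_arc G e t0) -> closure W2 (edge_arc G e t0) ->
  closure W3 (edge_arc G e t0) -> False.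
Proof.
move=> eE t01 oW1 oW2 oW3 W12 W13 W23 WU cl1 cl2 cl3.
pose arc := edge_arc G e; pose p := arc t0.
have [U [f [g [[oU Up] cf cg [Ug gf] fg]]]] := surface_chart hS p.
have arcc t : 0 < t < 1 -> {for t, continuous arc}.
  move=> t01'; have tin : t \in `]0, 1[ by rewrite in_itv.
  have : {within `]0, 1[, continuous arc}.
    by apply: continuous_subspaceW (@edge_arc_continuous _ _ _ _ G _ eE); exact: subset_itv_oo_cc.
  by rewrite continuous_open_subspace; [apply; rewrite inE|exact: interval_open].
have [eta [eta0 eta1 eta2 etaP]] : exists eta, [/\ 0 < eta, 0 < t0 - eta, t0 + eta < 1 &
    forall t, `|t0 - t| <= eta -> U (arc t)].
  have : nbhs t0 (arc @^-1` U) by apply: (arcc _ t01); exact: open_nbhs_nbhs.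
  move=> /nbhs_ballP[r /= r0 rU].
  pose eta := Num.min (r / 2) (Num.min (t0 / 2) ((1 - t0) / 2)).
  have /andP[? ?] := t01.
  have h1 : eta <= r / 2 by rewrite ge_min lexx.
  have h2 : eta <= t0 / 2 by rewrite !ge_min lexx orbT.
  have h3 : eta <= (1 - t0) / 2 by rewrite !ge_min lexx !orbT.
  have eta0 : 0 < eta by rewrite !lt_min !divr_gt0// subr_gt0.
  exists eta; split => //; [lra|lra|move=> t ht].
  by apply: rU; rewrite -ball_normE /=; lra.
pose a := t0 - eta; pose b := t0 + eta.
have inab t : a <= t <= b -> U (arc t) /\ 0 < t < 1.
  rewrite /a /b => /andP[? ?]; split.
    by apply: etaP; rewrite ler_norml; apply/andP; split; lra.
  by apply/andP; split; lra.
(* Away from [far] and the rest of the graph, the drawing near [p] consists of the short piece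
   alone. Injectivity of the arc keeps [p] off [far]. *)
pose far := arc @` `[0, a] `|` arc @` `[b, 1].
have cfar : closed far by apply: closedU; apply: closed_arc => //; rewrite /a /b; lra.
have pfar : ~ far p.
  have inj t : 0 <= t <= 1 -> arc t = p -> t = t0.
    have /andP[? ?] := t01.
    move=> t01' tp; apply: (@edge_arc_inj _ _ _ _ G _ eE) => //;
      rewrite inE/= in_itv/= //; apply/andP; split; lra.
  move=> [] [t /=]; rewrite in_itv/= /a /b => /andP[? ?] /inj tt0.
    suff : t = t0 by lra.
    by apply: tt0; apply/andP; split; lra.
  suff : t = t0 by lra.
  by apply: tt0; apply/andP; split; lra.
pose N := U `&` ~` rest_of_graph e `&` ~` far.
have Np : nbhs p N.
  apply: open_nbhs_nbhs; split.
    by apply: openI; [apply: openI => //|]; apply: closed_openC => //;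
      exact: closed_rest_of_graph.
  by split => //; split => //; exact: inner_not_rest.
have gfp : g (f p) = p by apply: fg; rewrite inE.
have /nbhs_ballP[r /= r0 rN] : nbhs (f p) (g @^-1` N) by apply: cg; rewrite gfp.
have garc t : a <= t <= b -> g (f (arc t)) = arc t.
  by move=> /inab[Ut _]; apply: fg; rewrite inE.
have clO W : closure W p -> closure (g @^-1` W) (f p).
  move=> clW B fB; have : nbhs p (U `&` f @^-1` B).
    by apply: filterI; [exact: open_nbhs_nbhs|apply: cf; rewrite ?inE].
  move=> /clW[q [Wq [Uq Bq]]]; exists (f q); split => //.
  by rewrite /= fg// inE.
have pre0 W W' : W `&` W' = set0 -> g @^-1` W `&` g @^-1` W' = set0.
  by rewrite -preimage_setI => ->; rewrite preimage_set0.
have opre W : open W -> open (g @^-1` W).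
  by move=> oW; apply: open_comp => // z _; exact: cg.
apply: (@arc_two_sided R (f \o arc) a b t0 r (g @^-1` W1) (g @^-1` W2) (g @^-1` W3));
  try exact: clO; try exact: pre0; try exact: opre; try by [].
- by rewrite /a /b; apply/andP; split; lra.
- apply: continuous_in_subspaceT => t; rewrite inE/= in_itv/= => /inab[Ut t01'].
  by apply: continuous_comp; [exact: arcc|apply: cf; rewrite inE].
- move=> t t'; rewrite !inE/= => tab tab' /= ftt'.
  have [_ /andP[? ?]] := inab _ tab; have [_ /andP[? ?]] := inab _ tab'.
  apply: (@edge_arc_inj _ _ _ _ G _ eE);
    try by rewrite inE/= in_itv/=; apply/andP; split; lra.
  by change (arc t = arc t'); rewrite -(garc t tab) -(garc t' tab') ftt'.
- apply/seteqP; split => // z [[t /=]]; rewrite in_itv/= => tab <- /=.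
  change ((W1 `|` W2 `|` W3) (g (f (arc t))) -> False); rewrite WU garc//; apply.
  by right; exists e => //; exists t => //; rewrite /= in_itv/=;
    have [_ /andP[? ?]] := inab _ tab; apply/andP; split; lra.
- move=> z zr; have Nz : N (g z) by apply: rN; rewrite -ball_normE /= distrC.
  have [gz|gz] := pselect (drawn_graph G (g z)); last first.
    by left; change ((W1 `|` W2 `|` W3) (g z)); rewrite WU.
  right; case: Nz => -[_ nrest] nfar.
  case: (graph_rest e gz) => [//|[t /=]]; rewrite in_itv/= => /andP[t0' t1'] tz.
  have ta : a < t.
    rewrite ltNge; apply/negP => ta; apply: nfar; left; exists t => //=.
    by rewrite in_itv/= t0'.
  have tb : t < b.
    rewrite ltNge; apply/negP => ta'; apply: nfar; right; exists t => //=.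
    by rewrite in_itv/= t1' andbT.
  exists t; first by rewrite /= in_itv/= !ltW.
  by rewrite /= /arc tz gf.
Qed.

End DrawnGraph.

(** * Faces meeting at an edge, and edge-closed sets of even faces *)

Section EvenFaces.
Variables (R : realType) (S : topologicalType).
Hypothesis hS : connected_closed_surface R S.
Variables (V : finType) (adj : rel V) (G : embedding R adj S).
Implicit Types (e : {set V}) (f g : set S) (c : seq V).

(** [edge_two_sided] is applied with the union of all other faces as third open set. This excludes
    both a third face at the point and infinitely many faces accumulating there. *)
Lemma edge_faces e (t : R) f1 f2 : e \in edges adj -> 0 < t < 1 ->
  faces G f1 -> faces G f2 -> f1 <> f2 ->
  closure f1 (edge_arc G e t) -> closure f2 (edge_arc G e t) ->
  exists2 N, nbhs (edge_arc G e t) N & N `<=` f1 `|` f2 `|` drawn_edge G e.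
Proof.
move=> eE t01 F1 F2 f12 cl1 cl2; set p := edge_arc G e t in cl1 cl2 *.
pose W := \bigcup_(f in [set f | faces G f /\ f <> f1 /\ f <> f2]) f.
have disj f g : faces G f -> faces G g -> f <> g -> f `&` g = set0.
  move=> Ff Fg fg; apply/seteqP; split => // q [fq gq].
  by apply: fg; exact: (face_eq Ff Fg fq gq).
have disjW f : f = f1 \/ f = f2 -> f `&` W = set0.
  move=> ff; apply/seteqP; split => // q [fq [g [Fg [g1 g2]] gq]].
  have Ff : faces G f by case: ff => ->.
  by have := face_eq Ff Fg fq gq; case: ff => -> ?; [apply: g1|apply: g2].
have nclW : ~ closure W p.
  apply: (@edge_two_sided R S hS V adj G e t f1 f2 W) => //.
  - exact: open_faces F1.
  - exact: open_faces F2.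
  - by apply: bigcup_open => f [Ff _]; exact: open_faces Ff.
  - exact: disj.
  - by apply: disjW; left.
  - by apply: disjW; right.
  apply/seteqP; split => q.
    by move=> [[|]|[f [Ff _]]]; apply: face_compl => //.
  move=> /face_of[f Ff fq].
  have [<-|ff1] := pselect (f = f1); first by left; left.
  have [<-|ff2] := pselect (f = f2); first by left; right.
  by right; exists f.
have [B pB BW] : exists2 B, nbhs p B & B `&` W = set0.
  exists (~` closure W); last first.
    by apply/seteqP; split => // q [ncl Wq]; apply: ncl; exact: subset_closure.
  by apply: open_nbhs_nbhs; split => //; apply: closed_openC; exact: closed_closure.
exists (B `&` ~` rest_of_graph G e).
  apply: filterI => //; apply: open_nbhs_nbhs; split.
    by apply: closed_openC; exact: closed_rest_of_graph hS _ _ _ _.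
  exact: inner_not_rest.
move=> q [Bq nrest].
have [/(graph_rest e)[]// eq|/face_of[f Ff fq]] := pselect (drawn_graph G q).
  by right.
have [<-|ff1] := pselect (f = f1); first by left; left.
have [<-|ff2] := pselect (f = f2); first by left; right.
by exfalso; have : (B `&` W) q by [split => //; exists f]; rewrite BW.
Qed.

Lemma cycle_edges_sub c : simple_cycle adj c -> cycle_edges c \subset edges adj.
Proof.
move=> [/andP[cc uc] _]; apply/fintype.subsetP => e /imsetP[v vc ->].
rewrite inE; apply/existsP; exists v; apply/existsP; exists (next c v).
by rewrite (next_cycle cc vc) eqxx.
Qed.

(** The midpoint of a drawn edge lies on no other drawn edge. *)
Lemma drawn_edges_inj (A B : {set {set V}}) : A \subset edges adj ->
  B \subset edges adj ->
  \bigcup_(e in [set e | e \in A]) drawn_edge G e `<=`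
  \bigcup_(e in [set e | e \in B]) drawn_edge G e -> A \subset B.
Proof.
move=> /fintype.subsetP AE /fintype.subsetP BE AB; apply/fintype.subsetP => e eA.
have half01 : 0 < (2^-1 : R) < 1 by apply/andP; split; lra.
have [|e' /= e'B pe'] := AB (edge_arc G e 2^-1).
  exists e => //; exists 2^-1 => //; rewrite /= in_itv/=; apply/andP; split; lra.
have [<-//|ee'] := eqVneq e' e.
exfalso; apply: (inner_not_rest (AE _ eA) half01).
by right; exists e'; [split => //; exact: BE|exact: pe'].
Qed.

Lemma face_edgesE f c : frontier_cycle G f c -> face_edges G f = cycle_edges c.
Proof.
move=> [sc fc]; apply/eqP; rewrite finset.eqEsubset; apply/andP; split; apply/fintype.subsetP => e.
  rewrite inE => /asboolP[c' [sc' fc'] ec'].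
  suff /fintype.subsetP : cycle_edges c' \subset cycle_edges c by apply.
  by apply: drawn_edges_inj; [exact: cycle_edges_sub|exact: cycle_edges_sub|rewrite -fc -fc'].
by move=> ec; rewrite inE; apply/asboolP; exists c.
Qed.

Lemma even_face_cycle f : even_faces G f ->
  exists2 c, simple_cycle adj c & face_edges G f = cycle_edges c.
Proof. by move=> [_ [c fc _]]; exists c; [case: fc|exact: face_edgesE]. Qed.

Lemma face_edges_sub f : even_faces G f -> face_edges G f \subset edges adj.
Proof. by move=> /even_face_cycle[c sc ->]; exact: cycle_edges_sub. Qed.

Lemma even_face_closure f : even_faces G f -> closure f =
  f `|` \bigcup_(e in [set e | e \in face_edges G f]) drawn_edge G e.
Proof.
move=> [Ff [c fc _]]; rewrite (face_edgesE fc) closure_open_frontier.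
  by have [_ ->] := fc.
exact: open_faces Ff.
Qed.

Lemma face_edge_closure f e : even_faces G f -> e \in face_edges G f ->
  drawn_edge G e `<=` closure f.
Proof. by move=> ef eE p ep; rewrite even_face_closure//; right; exists e. Qed.

Lemma face_edges_at_most_two e f1 f2 f3 :
  even_faces G f1 -> even_faces G f2 -> even_faces G f3 ->
  e \in face_edges G f1 -> e \in face_edges G f2 -> e \in face_edges G f3 ->
  f1 <> f2 -> f3 = f1 \/ f3 = f2.
Proof.
move=> E1 E2 E3 e1 e2 e3 f12; have eE := fintype.subsetP (face_edges_sub E1) _ e1.
have half01 : 0 < (2^-1 : R) < 1 by apply/andP; split; lra.
have mid : drawn_edge G e (edge_arc G e 2^-1).
  by exists 2^-1 => //; rewrite /= in_itv/=; apply/andP; split; lra.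
have [[F1 _] [[F2 _] [F3 _]]] := conj E1 (conj E2 E3).
have [N pN Nsub] := edge_faces eE half01 F1 F2 f12
  (face_edge_closure E1 e1 mid) (face_edge_closure E2 e2 mid).
have [q [f3q /Nsub]] := face_edge_closure E3 e3 mid pN.
move=> [[f1q|f2q]|eq].
- by left; exact: face_eq F3 F1 f3q f1q.
- by right; exact: face_eq F3 F2 f3q f2q.
- by exfalso; apply: (face_compl F3 f3q); apply: (drawn_edge_graph eE).
Qed.

Lemma edge_closed_faces (Z : set (set S)) : finite_set Z -> Z !=set0 ->
  Z `<=` even_faces G ->
  (forall f e, Z f -> e \in face_edges G f ->
    exists g, [/\ Z g, g <> f & e \in face_edges G g]) ->
  faces G `<=` Z.
Proof.
move=> finZ [f0 Zf0] Zev Zedge.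
have hausS : hausdorff_space S by have [] := hS.
(* [K] is closed. It is shown to be open, first at points of faces, then at inner points of edges,
   then at vertices; connectedness of the surface makes it everything. *)
pose K := \bigcup_(f in Z) closure f.
have cK : closed K by apply: closed_bigcup => // f _; exact: closed_closure.
have ZF f : Z f -> faces G f by move=> /Zev[].
have near_face f p : Z f -> f p -> nbhs p K.
  move=> Zf fp; apply: (@filterS _ _ _ f).
    by move=> q fq; exists f => //; exact: subset_closure.
  by apply: open_nbhs_nbhs; split => //; apply: open_faces (ZF _ Zf).
have near_edge p : K p -> ~ range (vertex_point G) p -> nbhs p K.
  move=> [f Zf]; rewrite even_face_closure; last exact: Zev.
  move=> [fp _|[e /= ef [t t01 tp]]]; first exact: near_face fp.
  have eE := fintype.subsetP (face_edges_sub (Zev _ Zf)) _ ef.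
  move: t01; rewrite /= in_itv/= => t01 nv.
  have [t01'|] := edge_arc_inner G eE t01; last by rewrite tp.
  have ep : drawn_edge G e p by exists t => //; rewrite /= in_itv.
  have [g [Zg gf eg]] := Zedge f e Zf ef.
  have clf := face_edge_closure (Zev _ Zf) ef.
  have clg := face_edge_closure (Zev _ Zg) eg.
  have fg : f <> g by move=> fg; apply: gf.
  rewrite -tp in ep *.
  have [N pN Nsub] := edge_faces eE t01' (ZF _ Zf) (ZF _ Zg) fg (clf _ ep) (clg _ ep).
  apply: filterS pN => q /Nsub[[fq|gq]|eq].
  - by exists f => //; exact: subset_closure.
  - by exists g => //; exact: subset_closure.
  - by exists f => //; exact: clf.
(* A punctured disc around [p] without other vertices is connected. In it [K] is relatively closed,
   open by [near_edge], and nonempty since [p] is adherent to a face of [Z]; so [K] contains it. *)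
have near_vertex p : K p -> range (vertex_point G) p -> nbhs p K.
  move=> [f Zf fp] vp.
  pose others := range (vertex_point G) `\ p.
  have cothers : closed others.
    apply: compact_closed => //; apply: finite_compact.
    apply: (sub_finite_set (B := range (vertex_point G))); first by move=> q [].
    exact/finite_image/finite_finset.
  have [|N [pN Nsub _ cN]] := @disc_nbhd R S hS p (~` others).
    by apply: open_nbhs_nbhs; split; [exact: closed_openC|case=> _; apply].
  have NK q : (N `\ p) q -> K q -> nbhs q K.
    move=> [Nq qp] Kq; apply: near_edge => // vq.
    exact: (Nsub q Nq).
  have : K `&` (N `\ p) = N `\ p.
    apply: cN.
    - have Fp : ~ f p.
        move=> /(face_compl (ZF _ Zf)); apply.
        by left.
      have [q [fq Nq]] := fp _ pN.
      exists q; split; first by exists f => //; exact: subset_closure.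
      by split => // qp; apply: Fp; rewrite -qp.
    - exists (interior K); first exact: open_interior.
      apply/seteqP; split => q [h1 h2]; split => //.
        exact: NK.
      exact: interior_subset h2.
    - by exists K => //; rewrite setIC.
  move=> NKE; apply: filterS pN => q Nq.
  have [->|qp] := pselect (q = p); first by exists f.
  by have : (N `\ p) q by []; rewrite -NKE => -[].
have oK : open K.
  rewrite openE => p Kp; rewrite /interior.
  by have [vp|vp] := pselect (range (vertex_point G) p); [exact: near_vertex|exact: near_edge].
have KT : K = [set: S].
  have [_ _ cS _] := hS; apply: cS.
  - have [q qG qf0] := ZF _ Zf0.
    have f0q : f0 q.
      rewrite qf0; exact: connected_component_refl.
    by exists q, f0 => //; exact: subset_closure.
  - by exists K => //; rewrite setTI.
  - by exists K => //; rewrite setTI.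
move=> f [q qG fE].
have fq : f q by rewrite fE; exact: connected_component_refl.
have : K q by rewrite KT.
move=> [g Zg]; rewrite even_face_closure; last exact: Zev.
move=> [gq|[e /= eg eq]].
  have Ff : faces G f by exists q.
  by rewrite (face_eq Ff (ZF _ Zg) fq gq).
by exfalso; apply: qG; apply: drawn_edge_graph eq; exact: fintype.subsetP (face_edges_sub (Zev _ Zg)) _ eg.
Qed.

End EvenFaces.

(** * Flips of perfect matchings along cycles *)

Section FlipWalks.
Local Open Scope nat_scope.
Local Open Scope set_scope.
Variables (V : finType) (adj : rel V).
Local Notation matching := {set {set V}}.
Local Notation cyc := {set {set V}}.
Local Notation pm := (perfect_matching adj).
Implicit Types (M N : matching) (C D : cyc) (e : {set V}) (v : V).

Definition star M v : {set {set V}} := [set e in M | v \in e].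

Lemma symdK A C : @symd {set V} (symd A C) C = A.
Proof. by apply/setP => e; rewrite !in_symd addbK. Qed.

Lemma pm_star M v : pm M -> #|star M v| = 1.
Proof. by move=> /andP[_ /forallP/(_ v)/eqP]. Qed.

Lemma star_symd M C v : star (symd M C) v = symd (star M v) (star C v).
Proof. by apply/setP => e; rewrite !(inE, in_symd); case: (v \in e); rewrite ?andbT ?andbF. Qed.

Lemma card_symd (T : finType) (A B : {set T}) : #|symd A B| + 2 * #|A :&: B| = #|A| + #|B|.
Proof.
have -> : #|symd A B| = #|A :\: B| + #|B :\: A|.
  rewrite /symd cardsU (_ : _ :&: _ = finset.set0) ?cards0 ?subn0//.
  by apply/setP => x; rewrite !inE; case: (x \in A); case: (x \in B).
rewrite -(cardsID B A) -(cardsID A B) (finset.setIC B A); lia.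
Qed.

(** With [i] common edges and [c] edges of [C] at [v], counting gives [1 + 2 i = 1 + c]. As [i <= 1]
    and [c > 0], this forces [i = 1] and [c = 2]. *)
Lemma flip_star M C v : pm M -> pm (symd M C) -> star C v != finset.set0 ->
  #|star M v :&: star C v| = 1 /\ #|star C v| = 2.
Proof.
move=> /(pm_star v) M1 /(pm_star v); rewrite star_symd => MC1; rewrite -card_gt0 => C0.
have := card_symd (star M v) (star C v); rewrite MC1 M1.
have := subset_leq_card (finset.subsetIl (star M v) (star C v)); lia.
Qed.

(** Whether [C] can be flipped depends only on the trace of the matching on [C], because the count
    at a vertex involves only the common edges of the two stars. *)
Lemma flip_same_trace M M' C : pm M -> pm (symd M C) -> pm M' ->
  M :&: C = M' :&: C -> pm (symd M' C).
Proof.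
move=> pM pMC pM' MM'; apply/andP; split.
  apply/fintype.subsetP => e; rewrite in_symd.
  have /andP[/fintype.subsetP M'E _] := pM'; have /andP[/fintype.subsetP MCE _] := pMC.
  have [eM' _|eM' /= eC] := boolP (e \in M'); first exact: M'E.
  apply: MCE; rewrite in_symd eC addbT; apply: contra eM' => eM.
  have : e \in M :&: C by rewrite inE eM eC.
  by rewrite MM' inE => /andP[].
apply/forallP => v; change (#|star (symd M' C) v| == 1); rewrite star_symd.
have [C0|C0] := eqVneq (star C v) finset.set0.
  by rewrite C0 symdC sym0d (pm_star v pM').
have [MC C2] := flip_star pM pMC C0.
have := card_symd (star M' v) (star C v).
have -> : star M' v :&: star C v = star M v :&: star C v.
  apply/setP => e; have /setP/(_ e) := MM'; rewrite !inE.
  by case: (v \in e); rewrite ?andbF ?andbT.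
rewrite MC C2 (pm_star v pM') => h; apply/eqP; lia.
Qed.

(** Along the cycle, the edges of a matching that can be flipped alternate. So whether [M] and [M']
    disagree at an edge, recorded by [k], is invariant under [next c] and hence constant on the
    cycle. *)
Lemma flip_trace C c M M' : simple_cycle adj c -> C = cycle_edges c ->
  pm M -> pm (symd M C) -> pm M' -> pm (symd M' C) ->
  M :&: C = M' :&: C \/ {in C, forall e, (e \in M) = (e \notin M')}.
Proof.
move=> [/andP[cc uc] c2] CE pM pMC pM' pMC'.
pose ed v : {set V} := [set v; next c v].
have edC v : v \in c -> ed v \in C by move=> vc; rewrite CE; apply/imsetP; exists v.
pose k v := (ed v \in M) (+) (ed v \in M').
have kinv : invariant (next c) k =1 xpredT.
  move=> v /=; rewrite /k.
  have [vc|vc] := boolP (v \in c); last by rewrite [next c v]next_nth (negbTE vc) eqxx.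
  have wc : next c v \in c by rewrite mem_next.
  have [->|e12] := eqVneq (ed (next c v)) (ed v); first by rewrite eqxx.
  have e1 : ed v \in star C (next c v) by rewrite inE edC// !inE eqxx orbT.
  have e2 : ed (next c v) \in star C (next c v) by rewrite inE edC// !inE eqxx.
  have C0 : star C (next c v) != finset.set0 by apply/finset.set0Pn; exists (ed v).
  have starE : star C (next c v) = [set ed v; ed (next c v)].
    apply/eqP; rewrite eq_sym finset.eqEcard; apply/andP; split.
      by apply/fintype.subsetP => e; rewrite !inE => /orP[]/eqP->; rewrite ?(inE, e1, e2) //;
         move: e1 e2; rewrite !inE => // -> ->.
    by rewrite (flip_star pM pMC C0).2 cards2 eq_sym e12.
  have one N : pm N -> pm (symd N C) -> (ed v \in N) (+) (ed (next c v) \in N).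
    move=> pN pNC; have [/eqP/finset.cards1P[x xE] _] := flip_star pN pNC C0.
    have xP e : (e \in N) && (e \in star C (next c v)) = (e == x).
      have /setP/(_ e) := xE; rewrite !inE => <-.
      by case: (e \in N); case: (e \in C); case: (_ \in e).
    have := xP (ed v); have := xP (ed (next c v)); rewrite e1 e2 !andbT => -> ->.
    have := xP x; rewrite starE eqxx inE => /andP[_]; rewrite !inE.
    rewrite (eq_sym x) (eq_sym x).
    case: eqP => [<-|_] /= => [_|/eqP->]; last by rewrite eqxx.
    by rewrite (negbTE e12).
  have := one M pM pMC; have := one M' pM' pMC'.
  by case: (ed v \in M); case: (ed v \in M'); case: (ed (next c v) \in M); case: (ed (next c v) \in M').
have [v0 v0c] : exists v0, v0 \in c by case: c c2 {cc uc CE ed edC k kinv} => // v0 c' _; exists v0; rewrite mem_head.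
have kE v : v \in c -> k v = k v0.
  move=> vc; apply/esym; apply: (fconnect_invariant kinv).
  by rewrite (fconnect_cycle (cycle_next uc) v0c).
have keE e : e \in C -> (e \in M) (+) (e \in M') = k v0.
  by rewrite CE => /imsetP[v vc ->]; rewrite -(kE v vc).
case k0 : (k v0).
  by right => e /keE; rewrite k0; case: (e \in M); case: (e \in M').
left; apply/setP => e; rewrite !inE.
by have [/keE|] := boolP (e \in C); rewrite ?andbF// !andbT k0; case: (e \in M); case: (e \in M').
Qed.

End FlipWalks.

Lemma graph_dist_walk (T : finType) (r : rel T) x y : connect r x y ->
  has_walk r x y (graph_dist r x y).
Proof.
move=> /connectP[p + ->] => /shortenP[p' rp' up' _]; set z := last x p'.
have yp' : last x p' = z by [].
have szp' : (size p' < #|T|)%N.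
  by rewrite -[(size p').+1]/(size (x :: p')) -(card_uniqP up'); exact: max_card.
have hw : has (has_walk r x z) (iota 0 #|T|).
  apply/hasP; exists (size p'); first by rewrite mem_iota.
  by apply/existsP; exists (in_tuple p'); rewrite rp' yp' eqxx.
have := nth_find 0%N hw; rewrite nth_iota ?add0n//.
by move: hw; rewrite has_find size_iota.
Qed.

Lemma graph_dist_min (T : finType) (r : rel T) x y n : has_walk r x y n ->
  (graph_dist r x y <= n)%N.
Proof.
move=> hn; have [nT|nT] := ltnP n #|T|; last first.
  by apply: leq_trans nT; rewrite /graph_dist -{2}(size_iota 0 #|T|) find_size.
rewrite leqNgt; apply/negP => nd; have := before_find 0%N nd.
by rewrite nth_iota// add0n hn.
Qed.

(** * Walks and distances in a component of the resonance graph *)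

Section ResonanceWalks.
Local Open Scope nat_scope.
Local Open Scope set_scope.
Variables (V : finType) (adj : rel V).
Local Notation matching := {set {set V}}.
Local Notation cyc := {set {set V}}.
Local Notation pm := (perfect_matching adj).
Variables (Fs : {set cyc}) (res : rel matching) (x0 : matching).
Hypothesis resE : forall M N, res M N = (symd M N \in Fs).
Let H : {set matching} := component (perfect_matchings adj) res x0.
Implicit Types (M N : matching) (C D : cyc) (s : seq cyc) (P : pred cyc).

Lemma symdKl M C : symd M (symd M C) = C.
Proof. by rewrite symdC (symdC M C) symdK. Qed.

Lemma in_pm M : (M \in perfect_matchings adj) = pm M.
Proof. by rewrite inE. Qed.

Lemma in_component M : (M \in H) =
  pm M && connect (restrict_rel (perfect_matchings adj) res) x0 M.
Proof. by rewrite /H /component inE in_pm. Qed.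

Lemma component_pm M : M \in H -> pm M.
Proof. by rewrite in_component => /andP[]. Qed.

Lemma component_step M C : M \in H -> C \in Fs -> pm (symd M C) -> symd M C \in H.
Proof.
move=> MH CF pMC; rewrite in_component pMC /=.
have := MH; rewrite in_component => /andP[pM xM]; apply: connect_trans xM _.
by apply: connect1; rewrite /restrict_rel /= !in_pm pM pMC resE symdKl.
Qed.

Lemma component_connect M N : M \in H -> N \in H -> connect (restrict_rel H res) M N.
Proof.
move=> MH NH.
have sym : connect_sym (restrict_rel (perfect_matchings adj) res).
  by apply: sym_connect_sym => M' N'; rewrite /restrict_rel /= !resE symdC andbCA.
have : connect (restrict_rel (perfect_matchings adj) res) M N.
  move: MH NH; rewrite !in_component => /andP[_ xM] /andP[_ xN].
  by apply: connect_trans xN; rewrite sym.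
move=> /connectP[p pp ->]; apply/connectP; exists p => //.
elim: p M pp MH {NH} => //= M' p IH M /andP[/and3P[MD M'D MM'] pp] MH.
have M'H : M' \in H.
  move: MH; rewrite !in_component => /andP[_ xM]; rewrite -in_pm M'D /=; apply: connect_trans xM _.
  by apply: connect1; rewrite /restrict_rel /= MD M'D.
by rewrite /restrict_rel /= MH M'H MM' /=; apply: IH.
Qed.

(* Walks in the component are encoded by their starting point and the cycles they flip. *)
Fixpoint fwalk M s : bool :=
  (M \in H) && (if s is C :: s' then (C \in Fs) && fwalk (symd M C) s' else true).

Definition fend M s : matching := foldl (@symd _) M s.

Definition labelled_rel P : rel matching :=
  [rel M N | restrict_rel H res M N && P (symd M N)].

Lemma fwalk_start M s : fwalk M s -> M \in H.
Proof. by case: s => [|C s] /andP[]. Qed.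

Lemma fwalk_cat M s t : fwalk M (s ++ t) = fwalk M s && fwalk (fend M s) t.
Proof.
elim: s M => [|C s IH] M /=; last by rewrite IH -!andbA.
by rewrite andbT; case: t => [|C t] /=; [rewrite !andbT andbb|case: (M \in H)].
Qed.

Lemma fend_cat M s t : fend M (s ++ t) = fend (fend M s) t.
Proof. exact: foldl_cat. Qed.

Lemma fwalk_end M s : fwalk M s -> fend M s \in H.
Proof. by rewrite -[s in fwalk _ s]cats0 fwalk_cat => /andP[_ /andP[]]. Qed.

Lemma fwalk_labels M s : fwalk M s -> {subset s <= Fs}.
Proof.
elim: s M => [//|C s IH] M /= /and3P[_ CF /IH sF] D.
by rewrite in_cons => /predU1P[->|/sF].
Qed.

Lemma fend_symd M C s : fend (symd M C) s = symd (fend M s) C.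
Proof.
elim: s M => //= D s IH M; rewrite -IH; congr fend.
by rewrite -!symdA (symdC C).
Qed.

Lemma path_fwalk P M p : M \in H -> path (labelled_rel P) M p ->
  exists s, [/\ size s = size p, fwalk M s, fend M s = last M p & all P s].
Proof.
elim: p M => [|M' p IH] M MH /=; first by exists [::]; split => //=; rewrite MH.
move=> /andP[/andP[/and3P[_ M'H MM'] PMM'] /(IH _ M'H)[s [ss sw se sP]]].
have M'E := symdKl M M'.
exists (symd M M' :: s); rewrite /= ss M'E sw se sP PMM' MH.
by rewrite -resE MM'.
Qed.

Lemma fwalk_path P M s : fwalk M s -> all P s ->
  exists p, [/\ size p = size s, path (labelled_rel P) M p & last M p = fend M s].
Proof.
elim: s M => [|C s IH] M /=; first by exists [::].
move=> /and3P[MH CF sw] /andP[PC /(IH _ sw)[p [sp pp pl]]].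
exists (symd M C :: p); rewrite /labelled_rel /restrict_rel /= sp pp pl MH (fwalk_start sw) resE.
by rewrite symdKl CF PC.
Qed.

Definition dist M N := graph_dist (restrict_rel H res) M N.

Lemma walk_has_walk M N n : M \in H -> has_walk (restrict_rel H res) M N n <->
  exists s, [/\ size s = n, fwalk M s & fend M s = N].
Proof.
move=> MH; split.
  move=> /existsP[p /andP[pp /eqP pN]].
  have pp' : path (labelled_rel predT) M p.
    by apply: sub_path pp => M' N' ?; apply/andP.
  have [s [ss sw se _]] := path_fwalk MH pp'.
  by exists s; rewrite ss se pN size_tuple.
move=> [s [<- sw <-]]; have [p [<- pp pl]] := fwalk_path sw (all_predT _).
apply/existsP; exists (in_tuple p); rewrite pl eqxx andbT.
by apply: sub_path pp => M' N' /andP[].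
Qed.

Lemma geodesic_exists M N : M \in H -> N \in H ->
  exists s, [/\ size s = dist M N, fwalk M s & fend M s = N].
Proof.
by move=> MH NH; apply/(walk_has_walk N _ MH); apply: graph_dist_walk; exact: component_connect.
Qed.

Lemma dist_min M s : fwalk M s -> dist M (fend M s) <= size s.
Proof.
move=> sw; apply: graph_dist_min; apply/(walk_has_walk _ _ (fwalk_start sw)).
by exists s.
Qed.

(* The vertex of T_f containing M, for C = E(f). *)
Definition avoid C M : {set matching} := component H (labelled_rel (predC1 C)) M.

Lemma avoidP C M N : M \in H ->
  reflect (exists s, [/\ fwalk M s, fend M s = N & C \notin s]) (N \in avoid C M).
Proof.
move=> MH; apply: (iffP idP).
  rewrite inE => /andP[NH /connectP[p pp ->]].
  have pp' : path (labelled_rel (predC1 C)) M p.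
    by apply: sub_path pp => M' N' /and3P[].
  have [s [_ sw se sC]] := path_fwalk MH pp'.
  exists s; split => //; apply/negP => Cs.
  by have /allP/(_ C Cs) := sC; rewrite /= eqxx.
move=> [s [sw <- Cs]]; rewrite inE (fwalk_end sw) /=.
have [|p [_ pp pl]] := fwalk_path (P := predC1 C) sw.
  by apply/allP => D Ds /=; apply: contraNneq Cs => <-.
apply/connectP; exists p => //.
by apply: sub_path pp => M' N' h; have /andP[/and3P[M'H N'H _] _] := h; apply/and3P.
Qed.

Lemma avoid_eq C M s : fwalk M s -> C \notin s -> avoid C M = avoid C (fend M s).
Proof.
move=> sw Cs.
have sym : connect_sym (restrict_rel H (labelled_rel (predC1 C))).
  apply: sym_connect_sym => M' N'; rewrite /labelled_rel /restrict_rel /= !resE symdC.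
  by case: (M' \in H); case: (N' \in H).
have Nav : fend M s \in avoid C M by apply/avoidP; [exact: fwalk_start sw|exists s].
move: Nav; rewrite inE => /andP[_ Nav]; apply/setP => N; rewrite !inE.
by rewrite (same_connect sym Nav).
Qed.

Lemma avoid_refl C M : M \in H -> M \in avoid C M.
Proof. by move=> MH; rewrite inE MH connect0. Qed.

End ResonanceWalks.

Lemma not_uniq_split (T : eqType) (s : seq T) : ~~ uniq s ->
  exists s1 x s2 s3, s = s1 ++ x :: s2 ++ x :: s3 /\ uniq (x :: s2).
Proof.
elim: s => //= x s IH; rewrite negb_and negbK.
have [us|/IH[s1 [y [s2 [s3 [-> us]]]]] _] := boolP (uniq s); last first.
  by exists (x :: s1), y, s2, s3.
rewrite orbF => /splitPr xs; case: xs us => s2 s3 us.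
exists [::], x, s2, s3; split => //=.
by move: us; rewrite cat_uniq /= => /and3P[-> /norP[-> _] _].
Qed.

(** * Independence of the face cycles and signed flip counts *)

Section FlipCounts.
Local Open Scope nat_scope.
Local Open Scope set_scope.
Variables (V : finType) (adj : rel V).
Local Notation matching := {set {set V}}.
Local Notation cyc := {set {set V}}.
Local Notation pm := (perfect_matching adj).
Variables (Fs : {set cyc}) (res : rel matching) (x0 : matching).
Hypothesis Fs_cycle : forall C, C \in Fs ->
  exists2 c, simple_cycle adj c & C = cycle_edges c.
Hypothesis Fs_indep : forall Z : {set cyc}, Z \subset Fs ->
  (forall C e, C \in Z -> e \in C -> exists C', [/\ C' \in Z, C' <> C & e \in C']) ->
  Z = finset.set0.
Local Notation fwalk := (fwalk adj Fs res x0).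
Implicit Types (M N : matching) (C D : cyc) (e : {set V}) (s t : seq cyc).

(** If just one term at some [e] differed from [idx], the total at [e] would too. So every edge of a
    cycle satisfying [w] lies on another such cycle, and [Fs_indep] leaves none. The general law
    [op] covers parities ([addb]) and integer counts ([+%R]). *)
Lemma Fs_indep_big (T : eqType) (idx : T) (op : Monoid.com_law idx)
    (F : {set V} -> cyc -> T) (w : pred cyc) :
  (forall e C, C \in Fs -> e \in C -> (F e C == idx) = ~~ w C) ->
  (forall e, \big[op/idx]_(C in Fs | e \in C) F e C = idx) ->
  {in Fs, forall C, ~~ w C}.
Proof.
move=> Fw F0 C CF; apply/negP => wC.
suff : C \in [set D in Fs | w D].
  rewrite (Fs_indep _ (Z := [set D in Fs | w D])) ?inE//.
    by apply/fintype.subsetP => D; rewrite inE => /andP[].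
  move=> {CF wC}C e; rewrite inE => /andP[CF wC] eC.
  have [/existsP[D /and4P[DF wD DC eD]]|] :=
    boolP [exists D, [&& D \in Fs, w D, D != C & e \in D]].
    by exists D; rewrite inE DF wD; split => //; exact/eqP.
  rewrite negb_exists => /forallP nD; exfalso.
  have := F0 e; rewrite (bigD1 C) ?CF//= big1 ?Monoid.mulm1.
    by move/eqP; rewrite Fw// wC.
  move=> D /andP[/andP[DF eD] DC]; apply/eqP; rewrite Fw//.
  by have := nD D; rewrite DF DC eD /= !andbT.
by rewrite inE CF wC.
Qed.

Lemma fend_mem M s e : {subset s <= Fs} ->
  (e \in fend M s) = (e \in M) (+) \big[addb/false]_(C in Fs | e \in C) odd (count_mem C s).
Proof.
elim: s M => [|C s IH] M sF; first by rewrite /= big1 ?addbF.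
have CF : C \in Fs by apply: sF; rewrite mem_head.
rewrite /= IH; last by move=> D Ds; apply: sF; rewrite in_cons Ds orbT.
rewrite in_symd -addbA; congr addb.
under [in RHS]eq_bigr => D _ do rewrite oddD.
rewrite big_split /=; congr addb.
have [eC|eC] := boolP (e \in C).
  rewrite (bigD1 C) ?CF//= eqxx big1// => D /andP[_ DC].
  by rewrite eq_sym (negbTE DC).
rewrite big1// => D /andP[_ eD]; case: eqP => // CD.
by rewrite CD eD in eC.
Qed.

(** Independence over the field of two elements. The labels only have to lie in [Fs]: [s] and [t]
    may pass through edge sets that are not matchings, as a listing of a parity set can do. *)
Lemma walk_parity M s t : {subset s <= Fs} -> {subset t <= Fs} -> fend M s = fend M t ->
  {in Fs, forall C, odd (count_mem C s) = odd (count_mem C t)}.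
Proof.
move=> sF tF st C CF.
pose w D := odd (count_mem D s) (+) odd (count_mem D t).
suff : ~~ w C by rewrite /w; case: odd; case: odd.
apply: (@Fs_indep_big _ false addb (fun=> w)) CF => e; first by move=> D _ _; case: (w D).
rewrite big_split /=; have := fend_mem M e sF; rewrite st (fend_mem M e tF).
by move=> /addbI ->; rewrite addbb.
Qed.

(** A reference edge of [C], fixing the orientation of flips; the default is not taken for [C] in
    [Fs]. *)
Definition base C : {set V} := odflt finset.set0 [pick e in C].

Lemma base_mem C : C \in Fs -> base C \in C.
Proof.
move=> /Fs_cycle[c [_ c2] ->]; rewrite /base; case: pickP => //= c0; exfalso.
case: c c2 c0 => // v c _ /(_ [set v; next (v :: c) v]).
by move=> /negP; apply; apply/imsetP; exists v; rewrite ?mem_head.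
Qed.

Local Open Scope ring_scope.

(** It tells which of the two perfect matchings of the cycle is present before the flip: +1 when the
    flip removes [base C], -1 when it inserts it. *)
Definition flip_sign M C : int := if base C \in M then 1 else -1.

(* For e in C, whether e and base C are on the same side of the bipartition of the
   cycle C into its two perfect matchings; meaningful only if some M can be
   flipped along C. *)
Definition edge_sign e C : int :=
  if [exists M, [&& pm M, pm (symd M C) & (e \in M) == (base C \in M)]] then 1 else -1.

Fixpoint signed_count D M s : int :=
  if s is C :: s' then (if D == C then flip_sign M C else 0) + signed_count D (symd M C) s'
  else 0.

(** By [flip_trace] two matchings that can be flipped along [C] agree on all of [C] or differ on all
    of it, so comparing [e] with [base C] gives the same answer in both. *)
Lemma edge_signP e C M : C \in Fs -> e \in C -> pm M -> pm (symd M C) ->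
  edge_sign e C = if (e \in M) == (base C \in M) then 1 else -1.
Proof.
move=> CF eC pM pMC; rewrite /edge_sign.
have bC := base_mem CF; have [c sc CE] := Fs_cycle CF.
case: existsP => [[M' /and3P[pM' pMC' /eqP eb]]|nM].
  suff -> : (e \in M) == (base C \in M) by [].
  have [MM'|MM'] := flip_trace sc CE pM pMC pM' pMC'.
    have inC x : x \in C -> (x \in M) = (x \in M').
      by move=> xC; have /setP/(_ x) := MM'; rewrite !inE xC !andbT.
    by rewrite !inC// eb.
  by rewrite !MM'// eb.
by case: eqP => // eb; exfalso; apply: nM; exists M; rewrite pM pMC eb eqxx.
Qed.

Lemma flip_mem e C M : C \in Fs -> e \in C -> pm M -> pm (symd M C) ->
  (e \in symd M C)%:R - (e \in M)%:R = - (edge_sign e C * flip_sign M C) :> int.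
Proof.
move=> CF eC pM pMC; rewrite (edge_signP CF eC pM pMC) /flip_sign in_symd eC addbT.
by case: (e \in M); case: (base C \in M).
Qed.

(** Telescoping: by [flip_mem], each flip of a cycle through [e] changes the membership of [e] by
    minus the product of the two signs. *)
Lemma walk_mem e M s : fwalk M s ->
  (e \in fend M s)%:R - (e \in M)%:R =
  - \sum_(C in Fs | e \in C) edge_sign e C * signed_count C M s :> int.
Proof.
elim: s M => [|C s IH] M /=; first by rewrite subrr big1 ?oppr0// => *; rewrite mulr0.
move=> /and3P[MH CF sw].
have pM := component_pm MH; have pMC := component_pm (fwalk_start sw).
under eq_bigr do rewrite mulrDr.
rewrite big_split /= opprD -IH//.
rewrite [LHS](_ : _ = ((e \in symd M C)%:R - (e \in M)%:R) +
  ((e \in fend (symd M C) s)%:R - (e \in symd M C)%:R)); last by rewrite /fend; ring.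
congr (_ + _).
have [eC|eC] := boolP (e \in C).
  rewrite flip_mem// (bigD1 C) ?CF//= eqxx big1 ?addr0// => D /andP[_ DC].
  by rewrite (negbTE DC) mulr0.
rewrite in_symd (negbTE eC) addbF subrr big1 ?oppr0// => D /andP[_ eD].
by case: eqP => [DC|_]; rewrite ?mulr0//; rewrite -DC eD in eC.
Qed.

(** This is the existence of heights. Along a closed walk the left side of [walk_mem] vanishes for
    every [e], and [edge_sign] is never 0, so [Fs_indep_big] applies with the nonvanishing of the
    counts as [w]. *)
Lemma closed_walk_count M s : fwalk M s -> fend M s = M ->
  {in Fs, forall C, signed_count C M s = 0}.
Proof.
move=> sw sM C CF; apply/eqP; rewrite -[_ == _]negbK.
apply: (@Fs_indep_big _ 0 +%R (fun e D => edge_sign e D * signed_count D M s)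
  (fun D => signed_count D M s != 0)) CF => e.
  move=> D _ _; rewrite negbK mulf_eq0 (_ : (edge_sign e D == 0) = false)//.
  by rewrite /edge_sign; case: ifP.
have := walk_mem e sw; rewrite sM subrr => /esym/eqP; rewrite oppr_eq0.
by move=> /eqP.
Qed.

Lemma signed_count_cat D M s t :
  signed_count D M (s ++ t) = signed_count D M s + signed_count D (fend M s) t.
Proof. by elim: s M => [|C s IH] M /=; rewrite ?add0r// IH addrA. Qed.

Lemma signed_count_notin D M s : D \notin s -> signed_count D M s = 0.
Proof.
elim: s M => //= C s IH M; rewrite in_cons negb_or => /andP[/negbTE -> Ds].
by rewrite add0r IH.
Qed.

End FlipCounts.

(** * Geodesics and quotient graphs *)

Section UniqueLabelGeodesics.
Local Open Scope nat_scope.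
Local Open Scope set_scope.
Variables (V : finType) (adj : rel V).
Local Notation matching := {set {set V}}.
Local Notation cyc := {set {set V}}.
Local Notation pm := (perfect_matching adj).
Variables (Fs : {set cyc}) (res : rel matching) (x0 : matching).
Hypothesis resE : forall M N, res M N = (symd M N \in Fs).
Hypothesis Fs_cycle : forall C, C \in Fs ->
  exists2 c, simple_cycle adj c & C = cycle_edges c.
Hypothesis Fs_two : forall (e : {set V}) C1 C2 C3, C1 \in Fs -> C2 \in Fs -> C3 \in Fs ->
  e \in C1 -> e \in C2 -> e \in C3 -> C1 <> C2 -> C3 = C1 \/ C3 = C2.
Hypothesis Fs_indep : forall Z : {set cyc}, Z \subset Fs ->
  (forall C e, C \in Z -> e \in C -> exists C', [/\ C' \in Z, C' <> C & e \in C']) ->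
  Z = finset.set0.
Let H : {set matching} := component (perfect_matchings adj) res x0.
Local Notation fwalk := (fwalk adj Fs res x0).
Local Notation avoid := (avoid adj res x0).
Local Notation dist := (dist adj res x0).
Implicit Types (M N : matching) (C D : cyc) (e : {set V}) (s t : seq cyc).

(** For [C] the edge set of a face [f] this is convertible with [quotient_edges], and the theorem
    uses it in this way. *)
Definition qedges C : {set {set {set matching}}} :=
  [set [set avoid C MN.1; avoid C MN.2] | MN in [set MN : matching * matching |
    restrict_rel H res MN.1 MN.2 && (symd MN.1 MN.2 == C)]].

Lemma qedgesP C E : reflect
  (exists M, [/\ C \in Fs, M \in H, symd M C \in H & E = [set avoid C M; avoid C (symd M C)]])
  (E \in qedges C).
Proof.
apply: (iffP imsetP) => [[[M N]]|[M [CF MH MCH ->]]].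
  rewrite inE /restrict_rel /= => /andP[/and3P[MH NH MN] /eqP CE] ->.
  by exists M; rewrite -CE symdKl -resE.
exists (M, symd M C) => //.
by rewrite inE /restrict_rel /= symdKl eqxx MH MCH resE symdKl CF.
Qed.

Definition uniq_geodesic M N s := [/\ fwalk M s, fend M s = N, size s = dist M N & uniq s].

Lemma uniq_count_even (T : eqType) (x : T) (s : seq T) :
  uniq s -> ~~ odd (count_mem x s) -> x \notin s.
Proof. by move=> us; rewrite count_uniq_mem//; case: (x \in s). Qed.

Lemma quotient_edges_le1 C : C \in Fs ->
  (forall M N, M \in H -> N \in H -> exists s, uniq_geodesic M N s) -> #|qedges C| <= 1.
Proof.
move=> CF geo; apply/card_le1_eqP => E E' /qedgesP[M [_ MH NH ->]] /qedgesP[M' [_ M'H N'H ->]].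
have par s t M1 : {subset s <= Fs} -> {subset t <= Fs} -> fend M1 s = fend M1 t ->
    odd (count_mem C s) = odd (count_mem C t).
  by move=> sF tF st; exact: (walk_parity Fs_indep sF tF st CF).
have consF s : {subset s <= Fs} -> {subset C :: s <= Fs}.
  by move=> sF D; rewrite in_cons => /predU1P[->|/sF].
have rconsF s : {subset s <= Fs} -> {subset s ++ [:: C] <= Fs}.
  by move=> sF D; rewrite mem_cat mem_seq1 => /orP[/sF|/eqP->].
have [s [sw se _ us]] := geo _ _ MH M'H; have sF := fwalk_labels sw.
(* The geodesic from [M] to [M'] decides how ends are paired. If it flips [C], then by parity the
   geodesics from [M] to [N'] and from [N] to [M'] do not; otherwise it avoids [C] itself, and so
   does the one from [N] to [N']. *)
have [Cs|Cs] := boolP (C \in s).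
  have [t [tw te _ ut]] := geo _ _ MH N'H; have tF := fwalk_labels tw.
  have [t' [tw' te' _ ut']] := geo _ _ NH M'H; have tF' := fwalk_labels tw'.
  have Ct : C \notin t.
    apply: uniq_count_even => //.
    have -> := par t (s ++ [:: C]) M tF (rconsF _ sF).
      by rewrite count_cat count_uniq_mem// Cs /= eqxx.
    by rewrite te fend_cat se.
  have Ct' : C \notin t'.
    apply: uniq_count_even => //.
    have : odd (count_mem C (C :: t')) = odd (count_mem C s).
      by apply: (par _ _ M) => //; [exact: consF|rewrite se /= -te'].
    by rewrite /= eqxx (count_uniq_mem _ us) Cs /=; case: odd.
  rewrite (avoid_eq resE tw Ct) te (avoid_eq resE tw' Ct') te'.
  by rewrite finset.setUC.
have [s' [sw' se' _ us']] := geo _ _ NH N'H; have sF' := fwalk_labels sw'.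
have Cs' : C \notin s'.
  apply: uniq_count_even => //.
  have : odd (count_mem C (C :: s')) = odd (count_mem C (s ++ [:: C])).
    apply: (par _ _ M); [exact: consF|exact: rconsF|].
    by rewrite fend_cat se /= -se'.
  by rewrite count_cat /= eqxx (count_uniq_mem _ us) (negbTE Cs) /=; case: odd.
by rewrite (avoid_eq resE sw Cs) se (avoid_eq resE sw' Cs') se'.
Qed.

(** Flips along cycles disjoint from [C] do not change the trace on [C], so [C] can be flipped at
    every moment of the walk, by [flip_same_trace]. *)
Lemma fwalk_flip_disjoint M C s : C \in Fs -> fwalk M s -> symd M C \in H ->
  (forall D e, D \in s -> e \in D -> e \notin C) -> fwalk (symd M C) s.
Proof.
move=> CF; elim: s M => [|D s IH] M /=; first by move=> _ ->.
move=> /and3P[MH DF sw] MCH disj; rewrite MCH DF /=.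
have -> : symd (symd M C) D = symd (symd M D) C by rewrite -!symdA (symdC C).
apply: IH => //; last by move=> D' e D's; apply: disj; rewrite in_cons D's orbT.
have MDH := fwalk_start sw.
apply: (component_step resE) => //.
apply: (flip_same_trace (component_pm MH) (component_pm MCH) (component_pm MDH)).
apply/setP => e; rewrite !inE; have [eC|] := boolP (e \in C); last by rewrite !andbF.
have [eD|eD] := boolP (e \in D); last by rewrite ?andbF ?orbF ?andbT.
by have := disj D e (mem_head _ _) eD; rewrite eC.
Qed.

Lemma geodesic_uniq M s : (forall C, C \in Fs -> #|qedges C| <= 1) ->
  fwalk M s -> size s = dist M (fend M s) -> uniq s.
Proof.
move=> q1 sw sd; apply/negPn/negP => /not_uniq_split[s1 [C [s2 [s3 [sE /andP[Cs2 us2]]]]]].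
move: sw; rewrite sE fwalk_cat => /andP[sw1]; set M0 := fend M s1.
rewrite -cat_cons fwalk_cat => /andP[sw2].
have [M0H CF sw2'] := and3P sw2; set M1 := symd M0 C in sw2'.
have M1H := fwalk_start sw2'.
rewrite -[fend M0 (C :: s2)]/(fend M1 s2); set M2 := fend M1 s2 => sw3.
have [M2H _ sw3'] := and3P sw3; set M3 := symd M2 C in sw3'.
have M3H := fwalk_start sw3'.
have [c sc CE] := Fs_cycle CF.
have M1C : symd M1 C = M0 by rewrite symdK.
have p1 := component_pm M1H; have p1' : pm (symd M1 C) by rewrite M1C; exact: component_pm M0H.
have p2 := component_pm M2H; have p2' := component_pm M3H.
have sF2 := fwalk_labels sw2'.
have [trace|opp] := flip_trace sc CE p1 p1' p2 p2'.
  (* If [D] in [s2] shared [e] with [C], then by [Fs_two] no third cycle passes through [e]. Since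
     [s2] flips [D] once and [C] never, the status of [e] would change between [M1] and [M2],
     against [trace]. *)
  have disj D e : D \in s2 -> e \in D -> e \notin C.
    move=> Ds2 eD; apply/negP => eC.
    have := fend_mem M1 e sF2; rewrite -/M2.
    have /setP/(_ e) := trace; rewrite !inE eC !andbT => ->.
    rewrite (bigD1 D) ?eD ?sF2//= big1 ?addbF.
      by rewrite count_uniq_mem// Ds2; case: (e \in M2).
    move=> D' /andP[/andP[D'F eD'] DD'].
    have CD : C <> D by move=> CD; rewrite CD Ds2 in Cs2.
    have [D'C|D'D] := Fs_two CF (sF2 _ Ds2) D'F eC eD eD' CD.
      by rewrite D'C count_uniq_mem// (negbTE Cs2).
    by rewrite D'D eqxx in DD'.
  (* Deleting both flips of [C] gives a walk with the same ends, shorter by two. *)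
  have sw' : fwalk M (s1 ++ s2 ++ s3).
    rewrite fwalk_cat sw1 -/M0 fwalk_cat -{1}M1C.
    rewrite (fwalk_flip_disjoint CF sw2') ?M1C//=.
    by rewrite -M1C fend_symd -/M2 -/M3.
  have se' : fend M (s1 ++ s2 ++ s3) = fend M s.
    rewrite sE !fend_cat -/M0 -[fend M0 (C :: _)]/(fend M1 (s2 ++ C :: s3)) fend_cat.
    by rewrite -{1}M1C fend_symd.
  have := dist_min resE sw'; rewrite se' -sd sE leqNgt => /negP; apply.
  by rewrite !size_cat /= size_cat /= ltn_add2l ltnS leq_add2l leqnSn.
(* Now the two flips of [C] have the same sign. As they induce the same edge of the quotient, [M3]
   is joined to [M0] without flipping [C]; this closes up a walk with signed count 2 or -2. *)
have sM0 : M0 \in avoid C M3.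
  have E1 : [set avoid C M0; avoid C M1] \in qedges C.
    by apply/qedgesP; exists M0.
  have E2 : [set avoid C M2; avoid C M3] \in qedges C.
    by apply/qedgesP; exists M2.
  have E12 : [set avoid C M0; avoid C M1] = [set avoid C M2; avoid C M3].
    by apply: (card_le1_eqP (q1 _ CF)).
  have a12 : avoid C M1 = avoid C M2 by rewrite (avoid_eq resE sw2' Cs2).
  have a0 : avoid C M0 \in [set avoid C M2; avoid C M3] by rewrite -E12 !inE eqxx.
  have a3 : avoid C M3 \in [set avoid C M0; avoid C M1] by rewrite E12 !inE eqxx orbT.
  suff <- : avoid C M0 = avoid C M3 by exact: avoid_refl.
  (* If [M0] were in the class of [M2], which is also that of [M1], the common edge would be a loop,
     and [M3] would be in this class as well. *)
  move: a0 a3; rewrite !inE => /orP[/eqP a0|/eqP//].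
  by rewrite a12 a0 orbb => /eqP.
have /(avoidP resE C M0 M3H)[t [tw te Ct]] := sM0.
pose w := (C :: s2) ++ (C :: t).
have ww : fwalk M0 w.
  by rewrite /w fwalk_cat sw2 /= M2H CF.
have we : fend M0 w = M0 by rewrite /w fend_cat.
have := closed_walk_count Fs_cycle Fs_indep ww we CF.
rewrite /w signed_count_cat /= !eqxx !signed_count_notin// !addr0.
rewrite -[fend (symd M0 C) s2]/M2 /flip_sign.
have := opp _ (base_mem Fs_cycle CF); rewrite in_symd (base_mem Fs_cycle CF) addbT.
by case: (base C \in M0); case: (base C \in M2).
Qed.

End UniqueLabelGeodesics.

Lemma card_eq_finset (T : finType) (A : {set T}) n :
  ([set x | x \in A] #= `I_n)%card <-> #|A| = n.
Proof.
pose X := [fset x in enum A]%fset.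
have -> : [set x | x \in A] = [set` X].
  by apply/seteqP; split => x /=; rewrite !inE /= mem_enum.
have -> : #|A| = #|` X|%fset.
  by rewrite card_fseq undup_id ?enum_uniq// cardE.
split; first by move/card_eq_fsetP.
by move=> ?; apply/card_eq_fsetP.
Qed.

Lemma fend_big (V : finType) (M : {set {set V}}) (s : seq {set {set V}}) :
  fend M s = symd M (\big[@symd _/finset.set0]_(C <- s) C).
Proof.
elim: s M => [|C s IH] M; first by rewrite big_nil symdC sym0d.
by rewrite /= -/(fend _ _) IH big_cons symdA.
Qed.

(** * The facial parity embedding *)

Section FacialParity.
Variables (R : realType) (S : topologicalType).
Hypothesis hS : connected_closed_surface R S.
Variables (V : finType) (adj : rel V) (G : embedding R adj S) (F : set (set S)).
Hypothesis F_proper : F `<` faces G.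
Hypothesis F_even : F `<=` even_faces G.
Variable x0 : {set {set V}}.
Let H := component (perfect_matchings adj) (resonant G F) x0.
Local Notation matching := {set {set V}}.
Implicit Types (f g : set S) (M N : matching) (s t : seq {set {set V}}) (B : set (set S)).

Definition face_cycles : {set {set {set V}}} :=
  [set C : {set {set V}} | `[< exists2 f, F f & C = face_edges G f >]]%SET.

Lemma face_cyclesP C : reflect (exists2 f, F f & C = face_edges G f) (C \in face_cycles).
Proof. by rewrite inE; exact: asboolP. Qed.

Lemma face_cycle_mem f : F f -> face_edges G f \in face_cycles.
Proof. by move=> Ff; apply/face_cyclesP; exists f. Qed.

Lemma resonant_face_cycles M N : resonant G F M N = (symd M N \in face_cycles).
Proof. by rewrite inE. Qed.

Lemma face_cycles_cycle C : C \in face_cycles ->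
  exists2 c, simple_cycle adj c & C = cycle_edges c.
Proof. by move=> /face_cyclesP[f Ff ->]; exact: even_face_cycle (F_even Ff). Qed.

Lemma face_cycles_two (e : {set V}) C1 C2 C3 :
  C1 \in face_cycles -> C2 \in face_cycles -> C3 \in face_cycles ->
  e \in C1 -> e \in C2 -> e \in C3 -> C1 <> C2 -> C3 = C1 \/ C3 = C2.
Proof.
move=> /face_cyclesP[f1 F1 ->] /face_cyclesP[f2 F2 ->] /face_cyclesP[f3 F3 ->] e1 e2 e3 C12.
have f12 : f1 <> f2 by move=> f12; apply: C12; rewrite f12.
have [->|->] := face_edges_at_most_two hS (F_even F1) (F_even F2) (F_even F3) e1 e2 e3 f12.
  by left.
by right.
Qed.

Lemma not_edge_closed Z : finite_set Z -> Z !=set0 -> Z `<=` F ->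
  (forall f e, Z f -> e \in face_edges G f ->
    exists g, [/\ Z g, g <> f & e \in face_edges G g]) -> False.
Proof.
move=> finZ Z0 ZF Zedge; have [_] := F_proper; apply.
have ZE := subset_trans ZF F_even; apply: subset_trans ZF.
exact: (edge_closed_faces hS finZ Z0 ZE Zedge).
Qed.

(** Two distinct faces with the same boundary edges would form an edge-closed set. *)
Lemma face_edges_inj f g : F f -> F g -> face_edges G f = face_edges G g -> f = g.
Proof.
move=> Ff Fg fg; apply: contrapT => nfg.
apply: (@not_edge_closed [set f; g]).
- by rewrite finite_setU; split; exact: finite_set1.
- by exists f; left.
- by move=> h [->|->].
- move=> h e [->|->] eh; [exists g|exists f]; split => //.
  + by right.
  + by move=> gf; apply: nfg.
  + by rewrite -fg.
  + by left.
  + by rewrite fg.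
Qed.

Lemma finite_faces Z : Z `<=` F -> finite_set Z.
Proof.
move=> ZF; pose k (C : {set {set V}}) := xget set0 [set f | F f /\ face_edges G f = C].
apply: (sub_finite_set (B := k @` setT)); last exact/finite_image/finite_finset.
move=> f Zf; exists (face_edges G f) => //.
have [Fk kE] : [set g | F g /\ face_edges G g = face_edges G f] (k (face_edges G f)).
  by apply: (@xgetI _ _ _ f); split => //; exact: ZF.
exact: face_edges_inj Fk (ZF _ Zf) kE.
Qed.

Lemma face_cycles_indep (Z : {set {set {set V}}}) : (Z \subset face_cycles)%SET ->
  (forall C e, C \in Z -> e \in C -> exists C', [/\ C' \in Z, C' <> C & e \in C']) ->
  Z = finset.set0.
Proof.
move=> /fintype.subsetP ZF Zedge; apply/eqP/negPn/negP => /finset.set0Pn[C CZ].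
pose Z' := [set f | F f /\ face_edges G f \in Z].
apply: (@not_edge_closed Z').
- by apply: finite_faces => f [].
- by have /face_cyclesP[f Ff CE] := ZF _ CZ; exists f; split => //; rewrite -CE.
- by move=> f [].
move=> f e [Ff fZ] ef; have [C' [C'Z C'f eC']] := Zedge _ _ fZ ef.
have /face_cyclesP[g Fg C'E] := ZF _ C'Z; exists g; split.
- by split => //; rewrite -C'E.
- by move=> gf; apply: C'f; rewrite C'E gf.
- by rewrite -C'E.
Qed.

Local Notation fwalk := (fwalk adj face_cycles (resonant G F) x0).
Local Notation cycs B := [seq face_edges G f | f <- enum_fset (fset_set B)].

Lemma big_faces B : B `<=` F ->
  \big[@symd _/finset.set0]_(f \in B) face_edges G f =
  \big[@symd _/finset.set0]_(C <- cycs B) C.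
Proof. by move=> BF; rewrite fsbig_finite; [rewrite big_map|exact: finite_faces]. Qed.

Lemma cycs_sub B : B `<=` F -> {subset cycs B <= face_cycles}.
Proof.
move=> BF C /mapP[f]; rewrite in_fset_set; last exact: finite_faces.
by rewrite inE => /BF Ff ->; exact: face_cycle_mem.
Qed.

Lemma count_cycs B f : B `<=` F -> F f ->
  count_mem (face_edges G f) (cycs B) = (f \in B).
Proof.
move=> BF Ff; have finB := finite_faces BF.
rewrite count_uniq_mem; last first.
  rewrite map_inj_in_uniq ?fset_uniq// => g h.
  by rewrite !in_fset_set// !inE => /BF Fg /BF Fh; exact: face_edges_inj.
congr nat_of_bool; apply/mapP/idP => [[g]|fB].
  by rewrite in_fset_set// => gB fg; rewrite (face_edges_inj Ff (BF _ (set_mem gB)) fg).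
by exists f; rewrite // in_fset_set.
Qed.

(** The faces flipped an odd number of times satisfy the defining property, so [get] returns a set
    that does; [walk_parity] shows that it contains the same faces. *)
Lemma facial_parity_walk M s f : M \in H -> fwalk M s -> F f ->
  facial_parity G F M (fend M s) f = odd (count_mem (face_edges G f) s).
Proof.
move=> MH sw Ff; have sF := fwalk_labels sw.
rewrite /facial_parity /parity_set; set P := (X in get X).
pose B0 := [set g | F g /\ odd (count_mem (face_edges G g) s)].
have B0F : B0 `<=` F by move=> g [].
have fendP B : B `<=` F -> P B <-> fend M (cycs B) = fend M s.
  move=> BF; rewrite fend_big /P /= big_faces//; split.
    by move=> [_ _ <-]; rewrite symdC symdK.
  move=> <-; split => //; first exact: finite_faces.
  by rewrite symdC symdKl.
have PB0 : P B0.
  apply/fendP => //; apply/setP => e; rewrite !(@fend_mem _ face_cycles)//; last exact: cycs_sub.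
  congr addb; apply: eq_bigr => C /andP[/face_cyclesP[g Fg ->] _].
  rewrite count_cycs// oddb; apply/idP/idP; first by rewrite inE => -[].
  by move=> h; rewrite inE.
have PB : P (get P) by exact: getI PB0.
have BF : get P `<=` F by case: PB.
move/(fendP _ BF) in PB.
have := walk_parity face_cycles_indep (cycs_sub BF) sF PB (face_cycle_mem Ff).
by rewrite count_cycs// oddb.
Qed.

(** Prefixing a walk from [Mstar] to [M] makes the base point disappear: the coordinates that differ
    are those of the faces flipped an odd number of times by [s]. *)
Lemma hamming_walk Mstar M s n : Mstar \in H -> M \in H -> fwalk M s ->
  hamming_dist_eq F (facial_parity G F Mstar M) (facial_parity G F Mstar (fend M s)) n <->
  #|[set C in face_cycles | odd (count_mem C s)]%SET| = n.
Proof.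
move=> SH MH sw; rewrite -card_eq_finset /hamming_dist_eq.
have [s0 [_ sw0 se0]] := geodesic_exists resonant_face_cycles SH MH.
have xM f : F f -> (facial_parity G F Mstar M f != facial_parity G F Mstar (fend M s) f) =
    odd (count_mem (face_edges G f) s).
  move=> Ff; rewrite -{1}se0 facial_parity_walk//.
  have sw' : fwalk Mstar (s0 ++ s) by rewrite fwalk_cat sw0 se0.
  have -> : fend M s = fend Mstar (s0 ++ s) by rewrite fend_cat se0.
  by rewrite facial_parity_walk// count_cat oddD; case: odd; case: odd.
set A := [set f | _ /\ _].
have -> : [set C | C \in [set C in face_cycles | odd (count_mem C s)]%SET] = face_edges G @` A.
  apply/seteqP; split => C /=.
    rewrite inE => /andP[/face_cyclesP[f Ff ->] Cs]; exists f => //.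
    by split => //; rewrite xM.
  move=> [f [Ff]]; rewrite xM// => Cs <-; rewrite inE Cs andbT.
  exact: face_cycle_mem.
rewrite (card_eql (inj_card_eq _))// => f g; rewrite !inE => -[Ff _] [Fg _].
exact: face_edges_inj.
Qed.

(** For a geodesic [s] this turns equality of Hamming and graph distance into the absence of
    repeated flips. *)
Lemma odd_labels_uniq s : {subset s <= face_cycles} ->
  #|[set C in face_cycles | odd (count_mem C s)]%SET| = size s <-> uniq s.
Proof.
move=> sF; set A := finset.finset _; split => [As|us].
  apply/card_uniqP/eqP; rewrite eqn_leq card_size -As; apply: subset_leq_card.
  apply/fintype.subsetP => C; rewrite inE => /andP[_ odd_C].
  by rewrite -has_pred1 has_count; case: (count _ _) odd_C.
rewrite -(card_uniqP us); apply: eq_card => C; rewrite inE count_uniq_mem//.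
by have [/sF ->//|] := boolP (C \in s); rewrite andbF.
Qed.

End FacialParity.

Theorem corollary5p1 (R : realType) (S : topologicalType)
    (hS : connected_closed_surface R S)
    (V : finType) (adj : rel V)
    (adj_sym : symmetric adj) (adj_irr : irreflexive adj)
    (G : embedding R adj S)
    (F : set (set S))
    (F_nonempty : F !=set0) (F_proper : F `<` faces G)
    (F_even : F `<=` even_faces G)
    (H : {set {set {set V}}}) (hH : is_resonance_component G F H)
    (Mstar : {set {set V}}) (hMstar : Mstar \in H) :
  isometric_on G F H (facial_parity G F Mstar) <->
  (forall f : set S, F f -> (#|quotient_edges G F H f| <= 1)%N).
Proof.
case: hH => x0 x0_pm HE; subst H.
have resE := resonant_face_cycles G F.
have cycP := face_cycles_cycle F_even.
have twoP := face_cycles_two hS F_even.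
have indP := face_cycles_indep hS F_proper F_even.
split.
  (* Any geodesic has as many flips as the Hamming distance of its ends, so isometry makes its
     labels distinct. *)
  move=> iso f Ff.
  apply: (quotient_edges_le1 resE indP (face_cycle_mem G Ff)) => M N MH NH.
  have [s [ss sw se]] := geodesic_exists resE MH NH.
  exists s; split => //; apply/(odd_labels_uniq (fwalk_labels sw)).
  have := iso M N MH NH; rewrite -{1}se.
  by move=> /(hamming_walk hS F_proper F_even _ hMstar MH sw) ->; rewrite ss.
move=> q1 M N MH NH.
have [s [ss sw se]] := geodesic_exists resE MH NH.
rewrite -{1}se; apply/(hamming_walk hS F_proper F_even _ hMstar MH sw).
rewrite -[graph_dist _ _ _]ss; apply/(odd_labels_uniq (fwalk_labels sw)).
apply: (geodesic_uniq resE cycP twoP indP _ sw); last by rewrite ss se.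
by move=> C /face_cyclesP[f Ff ->]; exact: q1.
Qed.
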